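(* A quintuple of octahedron type equations, one for each of the octahedra $\langle 0\rangle,\langle1\rangle,\langle2\rangle,\langle3\rangle,\langle4\rangle$ in $Q(A_4)$, is 4D consistent if and only if, in any quadruple of octahedra such that any two of them share a triangular face, the tripodal forms of any three equations sum up to the tripodal form of the fourth one. Explicitly, the latter condition means that for every partition $\{0,1,2,3,4\}=\{i,j,k,m\}\cup\{n\}$: (a) for the quadruple $\langle i\rangle,\langle j\rangle,\langle k\rangle,\langle m\rangle$ there are functions $A_{pq}=-A_{qp}$ ($p\ne q$ in $\{i,j,k,m\}$), where, with $\{r,s\}=\{i,j,k,m\}\setminus\{p,q\}$, $A_{pq}$ is a function of $x_{rn},x_{rs},x_{sn}$ (the fields on the common face of $\langle p\rangle$ and $\langle q\rangle$), such that for each $p\in\{i,j,k,m\}$ the equation on $\langle p\rangle$ is locally equivalent to $\sum_{q\in\{i,j,k,m\}\setminus\{p\}}A_{pq}=0$; (b) for the quadruple $T_i\langle i\rangle,T_j\langle j\rangle,T_k\langle k\rangle,T_m\langle m\rangle$ there are functions $B_{pq}=-B_{qp}$, where $B_{pq}$ is a function of $x_{pqr},x_{pqn},x_{pqs}$ with $\{r,s\}=\{i,j,k,m\}\setminus\{p,q\}$ (the fields on the common face of $T_p\langle p\rangle$ and $T_q\langle q\rangle$), such that for each $p\in\{i,j,k,m\}$ the equation on $T_p\langle p\rangle$ is locally equivalent to $\sum_{q\in\{i,j,k,m\}\setminus\{p\}}B_{pq}=0$.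
   Context: Lattice: $Q(A_4)=\{n=(n_0,\dots,n_4)\in\mathbb Z^5:\sum n_i=0\}$; for a complex lattice function $x$ write $x_{ij}=x(n+e_i+e_j)$ (base point with $\sum n_i=-2$) and $x_{ijk}=x(n+e_i+e_j+e_k)$ (base point with $\sum n_i=-3$), symmetric in the indices. $T_i$ denotes the shift in the $i$-th direction. The octahedron $\langle i\rangle=[jk\ell m]$, $\{i,j,k,\ell,m\}=\{0,\dots,4\}$, has the six vertices indexed by the pairs from $\{j,k,\ell,m\}$; $T_i\langle i\rangle$ has the six vertices indexed by triples consisting of $i$ and a pair from $\{j,k,\ell,m\}$. The octahedra $\langle 0\rangle,\dots,\langle 4\rangle$ are the octahedral facets of a 4-cell with ten vertices $x_{ij}$, and $T_0\langle0\rangle,\dots,T_4\langle 4\rangle$ are the octahedral facets of a 4-cell with ten vertices $x_{ijk}$; in each 4-cell any two octahedral facets share a triangular face. Octahedron type equation: a relation between the six fields at the vertices of an octahedron, given by a locally analytic function and irreducible: it can be locally solved with respect to any of the six variables, the result depending on all the others. The same equation is imposed on all translates of the octahedron. One works near a solution branch. Tripodal form: for an octahedron with a chosen triangular face (the head), a representation of the equation as a sum of three terms (legs) equal to zero, each leg being a function of the three fields on one of the three triangular faces which share exactly one edge with the head; the vertex of the leg not on the head enters only this leg. In (a), the equation on $\langle p\rangle$ is in tripodal form whose head consists of the three vertices $qn$, $q\in\{i,j,k,m\}\setminus\{p\}$; in (b), the head on $T_p\langle p\rangle$ consists of the three vertices $pqr$ with $q\neq r$ in $\{i,j,k,m\}\setminus\{p\}$.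 4D consistency: for three distinct indices $a,b,c$ and an index $i\notin\{a,b,c\}$, the triples of octahedra $\langle a\rangle,\langle b\rangle,\langle c\rangle$ and $T_aT_i^{-1}\langle a\rangle,T_bT_i^{-1}\langle b\rangle,T_cT_i^{-1}\langle c\rangle$ are called adjacent. A triple of equations for $\langle a\rangle,\langle b\rangle,\langle c\rangle$ is 4D consistent if these equations admit generic solutions when imposed simultaneously on any two adjacent triples of octahedra (no relation is forced between the nine independent initial data on the union of the two adjacent triples). A quintuple is 4D consistent if any three of its equations form a 4D consistent triple and the remaining two equations are fulfilled by virtue of these three. *)

(* Defs.v *)
From HB Require Import structures.
From mathcomp Require Import all_boot all_order all_algebra.
From mathcomp Require Import all_classical all_reals all_analysis.
From mathcomp Require Export complex.

Set Implicit Arguments.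
Unset Strict Implicit.
Unset Printing Implicit Defensive.

Import Order.TTheory GRing.Theory Num.Theory.
(* [I -> C] carries the sup-distance; for finite [I] this is the usual topology
   of C^I. *)
Import numFieldNormedType.Exports ArrowAsUniformType.

Local Open Scope classical_set_scope.
Local Open Scope ring_scope.

Section Analytic.
Variable C : numClosedFieldType.

(* [f] is the sum of a convergent power series in a polydisc around [z0].  The
   coefficient bound makes the series absolutely convergent there, so that
   summing over the cubes {0..N-1}^I is immaterial. *)
Definition analytic_at (I : finType) (f : (I -> C) -> C) (z0 : I -> C) : Prop :=
  exists (c : (I -> nat) -> C) (r M : C),
    [/\ 0 < r,
        forall a : I -> nat, `|c a| * r ^+ (\sum_i a i)%N <= M
      & forall z, (forall i, `|z i - z0 i| < r) ->
          (fun N : nat => \sum_(a : {ffun I -> 'I_N})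
             c (fun i => a i : nat) * \prod_i (z i - z0 i) ^+ a i)
            @ \oo --> f z].

Definition depends_on (I : finType) (f : (I -> C) -> C) (z0 : I -> C)
    (w : I) : Prop :=
  forall U, nbhs z0 U -> exists z z',
    [/\ U z, U z', forall u, u != w -> z u = z' u & f z != f z'].

(* Solvability with respect to the variable [v]: the function [f] takes the
   remaining variables as arguments. *)
Definition solvable_for (I : finType) (F : (I -> C) -> C) (z0 : I -> C)
    (v : I) : Prop :=
  exists f : ({w : I | w != v} -> C) -> C,
    [/\ analytic_at f (fun w => z0 (val w)),
        \forall z \near z0, F z = 0 <-> z v = f (fun w => z (val w))
      & forall w, depends_on f (fun u => z0 (val u)) w].

End Analytic.

(* Lattice points are vectors of Z^5.  The lattice Q(A_4) consists of those of
   height 0; a lattice function is given on all of Z^5, but only its values on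
   Q(A_4) are ever used. *)
Definition lattice_pt : Type := 'rV[int]_5.

Definition height (m : lattice_pt) : int := \sum_j m 0 j.

Definition e (i : 'I_5) : lattice_pt := delta_mx 0 i.

(* The subscript notation: x_{ij} = x (site m [set i; j]) with [height m = -2],
   x_{ijk} = x (site m [set i; j; k]) with [height m = -3]. *)
Definition site (m : lattice_pt) (E : {set 'I_5}) : lattice_pt :=
  m + \sum_(i in E) e i.

(* The six vertices of the octahedron <p>. *)
Definition oct_index (p : 'I_5) : finType :=
  {E : {set 'I_5} | (#|E| == 2%N) && (p \notin E)}.

(* The three vertices of the common face of <p> and <q>. *)
Definition face_index (p q : 'I_5) : finType :=
  {E : {set 'I_5} | [&& #|E| == 2%N, p \notin E & q \notin E]}.

(* The three vertices of the common face of T_p<p> and T_q<q>. *)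
Definition shifted_face_index (p q : 'I_5) : finType :=
  {E : {set 'I_5} | [&& #|E| == 3%N, p \in E & q \in E]}.

(* [(p, m)] is the translate of <p> with base point [m], [height m = -2].  In
   the 4-cell of the x_{ijk} with base point [n], [height n = -3], the facet
   T_p<p> is [(p, n + e p)]. *)
Definition octahedron : Type := ('I_5 * lattice_pt)%type.

Definition oct_sites (o : octahedron) : seq lattice_pt :=
  [seq site o.2 (val E) | E : oct_index o.1].

(* The two adjacent triples <a>, <b>, <c> and
   T_a T_i^{-1}<a>, T_b T_i^{-1}<b>, T_c T_i^{-1}<c>. *)
Definition adjacent_triples (a b c i : 'I_5) (m : lattice_pt) :
    seq octahedron :=
  [:: (a, m); (b, m); (c, m);
      (a, m + e a - e i); (b, m + e b - e i); (c, m + e c - e i)].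

(* Starting from values at the points of [D], the octahedra listed in [s] give
   one after another the value at the point paired with them. *)
Fixpoint determines (D : seq lattice_pt)
    (s : seq (octahedron * lattice_pt)) : bool :=
  if s is (o, v) :: s' then
    [&& v \in oct_sites o, v \notin D,
        all (fun w => (w == v) || (w \in D)) (oct_sites o)
      & determines (v :: D) s']
  else true.

(* Nine independent initial data on the fourteen vertices of two adjacent
   triples: the other five fields are found successively from five of the six
   equations. *)
Definition initial_data (os : seq octahedron) (D : seq lattice_pt) : Prop :=
  [/\ uniq D, size D = 9%N, {subset D <= flatten [seq oct_sites o | o <- os]}
    & exists s : seq (octahedron * lattice_pt),
        [/\ size s = 5%N, uniq [seq ov.1 | ov <- s],
            {subset [seq ov.1 | ov <- s] <= os} & determines D s]].

Section Quintuple.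
Variable C : numClosedFieldType.
Variable F : forall p : 'I_5, (oct_index p -> C) -> C.
Implicit Types (x : lattice_pt -> C) (o : octahedron) (m : lattice_pt).

Definition oct_fields x o : oct_index o.1 -> C := fun E => x (site o.2 (val E)).

Definition holds x o : Prop := F (oct_fields x (o := o)) = 0.

(* [x0] is a solution branch of the five equations, near which all of them are
   of octahedron type. *)
Definition octahedron_type_near (x0 : lattice_pt -> C) : Prop :=
  forall (p : 'I_5) m, height m = - 2%:Z ->
    let z0 := oct_fields x0 (o := (p, m)) in
    [/\ analytic_at (F (p := p)) z0, F z0 = 0
      & forall v, solvable_for (F (p := p)) z0 v].

(* Arbitrary values of the initial data, close to those of [x0], extend to a
   solution close to [x0]. *)
Definition generic_solutions (x0 : lattice_pt -> C) (os : seq octahedron) :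
    Prop :=
  forall D, initial_data os D ->
  forall U, nbhs x0 U -> \forall y \near x0,
    exists x : lattice_pt -> C,
      [/\ U x, {in D, x =1 y} & forall o, o \in os -> holds x o].

Definition consistent_triple (x0 : lattice_pt -> C) (a b c : 'I_5) : Prop :=
  forall (i : 'I_5) m, i \notin [:: a; b; c] -> height m = - 2%:Z ->
    generic_solutions x0 (adjacent_triples a b c i m).

(* The equations for <a>, <b>, <c> imply the one for <p>, on the octahedral
   facets of either kind of 4-cell. *)
Definition implied_by_triple (x0 : lattice_pt -> C) (a b c p : 'I_5) : Prop :=
  (forall m, height m = - 2%:Z -> \forall x \near x0,
     holds x (a, m) -> holds x (b, m) -> holds x (c, m) -> holds x (p, m))
  /\
  (forall n, height n = - 3%:Z -> \forall x \near x0,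
     holds x (a, n + e a) -> holds x (b, n + e b) -> holds x (c, n + e c) ->
     holds x (p, n + e p)).

Definition consistent_4D (x0 : lattice_pt -> C) : Prop :=
  forall a b c : 'I_5, uniq [:: a; b; c] ->
    consistent_triple x0 a b c /\
    (forall p, p \notin [:: a; b; c] -> implied_by_triple x0 a b c p).

(* Tripodal forms of <p>, p != n, on the 4-cell of the x_{ij}.  The
   antisymmetry A_pq = - A_qp is expressed on fields [xi] indexed by all pairs,
   because the index types of the common face attached to (p, q) and to (q, p)
   are only propositionally equal. *)
Definition tripodal_sum (x0 : lattice_pt -> C) (n : 'I_5)
    (m : lattice_pt) : Prop :=
  exists A : forall p q : 'I_5, (face_index p q -> C) -> C,
    [/\ forall p q, p != n -> q != n -> p != q ->
          forall xi : {set 'I_5} -> C,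
            A p q (fun E => xi (val E)) = - A q p (fun E => xi (val E)),
        forall p q, p != n -> q != n -> p != q ->
          analytic_at (A p q) (fun E => x0 (site m (val E)))
      & forall p, p != n -> \forall x \near x0,
          holds x (p, m) <->
          \sum_(q | (q != p) && (q != n))
             A p q (fun E => x (site m (val E))) = 0].

(* Tripodal forms of T_p<p>, p != n, on the 4-cell of the x_{ijk}. *)
Definition shifted_tripodal_sum (x0 : lattice_pt -> C) (n : 'I_5)
    (m : lattice_pt) : Prop :=
  exists B : forall p q : 'I_5, (shifted_face_index p q -> C) -> C,
    [/\ forall p q, p != n -> q != n -> p != q ->
          forall xi : {set 'I_5} -> C,
            B p q (fun E => xi (val E)) = - B q p (fun E => xi (val E)),
        forall p q, p != n -> q != n -> p != q ->
          analytic_at (B p q) (fun E => x0 (site m (val E)))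
      & forall p, p != n -> \forall x \near x0,
          holds x (p, m + e p) <->
          \sum_(q | (q != p) && (q != n))
             B p q (fun E => x (site m (val E))) = 0].

End Quintuple.

(* Main.v *)
(** View the four indices of a quadruple as the vertices of a tetrahedron, with the
    field [x_{qn}] at the vertex [q] and the field [x_{rs}] on the edge [rs]; the
    equation on <p> then relates the fields of the face opposite to [p].  (The 4-cell of the [x_{ijk}] becomes the same picture after taking
    complements of index sets.)  Up to signs the legs [A_pq] are functions [w_rs]
    of the edges, and the tripodal forms say that [w] is a cocycle on each of the
    four faces; the four cocycle conditions are dependent, so tripodal forms imply
    consistency.

    Conversely, fix the fields at a vertex [d] and the spoke [ad] at base values.
    Moving the spoke [ad] while keeping the edges [ab] and [ac] transports the
    spokes [bd] and [cd], and by consistency this preserves the edge [bc].  The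
    infinitesimal transport thus yields one-forms [p_b d(bd)], [p_c d(cd)] whose
    primitives [W_b], [W_c] have a difference depending only on the edge [bc] and
    its end points; this difference is [w_bc], and it gives the cocycle on the face [abc].
    Expressing its legs through the spokes, at arbitrary fields of [d], separates
    the variables and produces the remaining three legs.

    Analyticity of composites, divided differences and primitives is obtained from
    the fact that a function is analytic at a point if and only if it is a uniform
    limit of polynomials in a neighbourhood, which rests on Cauchy's estimates. *)

Require Import Defs.
From mathcomp Require Import all_boot all_order all_algebra.
From mathcomp Require Import all_classical all_reals all_analysis.
From mathcomp Require Import cyclic separable cyclotomic.
From mathcomp Require Import ring lra zify.

Set Implicit Arguments.
Unset Strict Implicit.
Unset Printing Implicit Defensive.

Import Order.TTheory GRing.Theory Num.Theory.
Import numFieldNormedType.Exports ArrowAsUniformType.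

Local Open Scope classical_set_scope.
Local Open Scope ring_scope.

(** * Complete archimedean fields *)

(** Analyticity is given by power series and comes without a calculus of derivatives. The
    infinitesimal transport is therefore expressed by divided differences: analytic functions of two
    values of one variable whose restriction to the diagonal is the derivative. Integration produces
    a primitive together with its divided difference, and a function is shown to be constant by the
    vanishing of its divided difference on the diagonal.

    A second obstacle is that the cocycle condition has to imply the equation and not merely follow
    from it, which requires the primitives to be locally injective. The transported spoke can be
    solved back for the original one, and the Lipschitz bound of this inverse keeps the derivative
    away from 0.

    Finally, the fields at [d] and on the spoke ad can be frozen only for the face opposite to [d].
    The legs on the spokes are recovered afterwards from an identity between functions of the three
    spokes, in which [d] varies again. *)

Definition archimedean (C : numFieldType) : Prop :=
  forall x : C, 0 < x -> exists n : nat, n.+1%:R^-1 < x.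

Definition cauchy_complete (C : numFieldType) : Prop :=
  forall u : nat -> C,
    (forall x, 0 < x -> exists N : nat, forall m n : nat,
       (N <= m)%N -> (N <= n)%N -> `|u m - u n| < x) ->
  exists l, forall x, 0 < x -> exists N : nat, forall n : nat,
    (N <= n)%N -> `|u n - l| < x.

(** Besides algebraic closedness, which supplies the roots of unity, these two properties are what
    the estimates use of the complex numbers; radii and errors are positive elements of the field
    itself. *)
Class complete_field (C : numFieldType) : Prop := CompleteField {
  field_archimedean : archimedean C;
  field_cauchy_complete : cauchy_complete C }.

Section Neighbourhoods.
Variables (C : numClosedFieldType) (I : choiceType).
Implicit Types (z : I -> C) (P : (I -> C) -> Prop).

Lemma near_ballP z P :
  (\forall w \near z, P w) <->
  exists2 d, 0 < d & forall w, (forall i, `|w i - z i| < d) -> P w.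
Proof.
split=> [/nbhs_ballP[d d0 dP]|[d d0 dP]].
  by exists d => // w wd; apply: dP => i /=; rewrite /ball/= distrC.
by apply/nbhs_ballP; exists d => // w wd; apply: dP => i; rewrite distrC; apply: wd.
Qed.

End Neighbourhoods.

(** * Completeness of the complex numbers *)

Section RealPart.
Variable R : realType.

Lemma gt0_complexE (x : R[i]) : 0 < x -> exists2 r : R, 0 < r & x = r%:C%C.
Proof.
by case: x => a b /=; rewrite ltcE/= => /andP[/eqP-> a0]; exists a.
Qed.

Lemma complex_archimedean : archimedean R[i].
Proof.
move=> x /gt0_complexE[r r0 ->].
have [n nr] : exists n : nat, n.+1%:R^-1 < r.
  exists (Num.truncn r^-1); rewrite invf_plt ?posrE//.
  by rewrite truncnS_gt.
exists n; have -> : (n.+1%:R^-1 : R[i]) = (n.+1%:R^-1)%:C%C.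
  by rewrite fmorphV rmorph_nat.
by rewrite ltcR.
Qed.

Lemma complex_cauchy_complete : cauchy_complete R[i].
Proof.
move=> u uC.
have real_lim (p : R[i] -> R) : (forall x y, `|p x - p y|%:C%C <= `|x - y|) ->
    exists l, forall e : R, 0 < e -> exists N : nat, forall n : nat,
    (N <= n)%N -> `|p (u n) - l| < e.
  move=> pL.
  have /cvg_ex[l ul] : cvgn (p \o u).
    apply/cauchy_cvgP/cauchy_exP => e e0.
    have [|N uN] := uC e%:C%C; first by rewrite ltcR.
    exists (p (u N)), N => // n Nn /=.
    rewrite /ball/= -ltcR; apply: le_lt_trans (pL _ _) _.
    exact: uN.
  exists l => e e0.
  have /cvgrPdist_lt/(_ e e0)[N _ lN] := ul.
  by exists N => n Nn; rewrite distrC; apply: lN.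
have [x y|a ua] := real_lim (@complex.Re R).
  by apply: le_trans (normc_ge_Re (x - y)); case: x => ? ?; case: y.
have [x y|b ub] := real_lim (@complex.Im R).
  case: x y => [x1 x2] [y1 y2]; rewrite normc_def/= lecR -sqrtr_sqr.
  by rewrite ler_wsqrtr// lerDr sqr_ge0.
exists (a +i* b)%C => _ /gt0_complexE[e e0 ->].
have e20 : 0 < e / 2 by rewrite divr_gt0.
have [N1 N1P] := ua _ e20; have [N2 N2P] := ub _ e20.
exists (maxn N1 N2) => n; rewrite geq_max => /andP[/N1P na /N2P nb].
have -> : u n - (a +i* b)%C = (complex.Re (u n) - a)%:C%C
     + 'i%C * (complex.Im (u n) - b)%:C%C.
  by case: (u n) => x y /=; simpc.
apply: le_lt_trans (ler_normD _ _) _.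
have norm_real (r : R) : `|r%:C%C| = `|r|%:C%C.
  by rewrite normc_def/= expr0n addr0 sqrtr_sqr.
have -> : `|'i%C * (complex.Im (u n) - b)%:C%C| = `|complex.Im (u n) - b|%:C%C.
  by rewrite normrM normc_def/= expr0n expr1n add0r sqrtr1 mul1r norm_real.
rewrite norm_real.
by rewrite -rmorphD ltcR [ltRHS](splitr e) ltrD.
Qed.

Lemma complex_complete_field : complete_field R[i].
Proof. exact: CompleteField complex_archimedean complex_cauchy_complete. Qed.

End RealPart.

(** * Polynomial functions *)

Section PolynomialFunctions.
Variable C : numClosedFieldType.
Implicit Types I J : finType.

Definition monomial I (z : I -> C) (a : I -> nat) : C := \prod_i z i ^+ a i.

Definition cube_sum I (N : nat) (u : (I -> nat) -> C) : C :=
  \sum_(a : {ffun I -> 'I_N}) u (fun i => a i : nat).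

(** The coefficients are indexed by all exponents rather than by those of one cube, so that families
    belonging to different cubes can be added and compared. *)
Definition poly_fun I (f : (I -> C) -> C) : Prop :=
  exists (c : (I -> nat) -> C) (N : nat),
    forall z, f z = cube_sum N (fun a => c a * monomial z a).

Lemma cube_sum_prod I N (u : I -> nat -> C) :
  cube_sum N (fun a => \prod_i u i (a i)) = \prod_i \sum_(j < N) u i j.
Proof. by rewrite bigA_distr_bigA. Qed.

Lemma cube_sum_widen I N N' (u : (I -> nat) -> C) : (N <= N')%N ->
  cube_sum N u =
  \sum_(a : {ffun I -> 'I_N'} | [forall i, a i < N]%N) u (fun i => a i : nat).
Proof.
move=> le_N.
pose h (a : {ffun I -> 'I_N}) : {ffun I -> 'I_N'} :=
  [ffun i => widen_ord le_N (a i)].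
have h_inj : injective h.
  move=> a b /ffunP ab; apply/ffunP => i; apply/val_inj.
  by have := congr1 val (ab i); rewrite !ffunE.
rewrite /cube_sum; transitivity (\sum_(b in h @: [set: {ffun I -> 'I_N}]%SET)
  u (fun i => b i : nat)).
  rewrite big_imset/=; last by move=> ? ? _ _; apply: h_inj.
  apply: eq_big => [a|a _]; first by rewrite inE.
  by congr u; apply/funext => i; rewrite ffunE.
apply: eq_bigl => b; apply/imsetP/forallP => [[a _ ->] i|bN].
  by rewrite ffunE /=.
exists [ffun i => Ordinal (bN i)]; first by rewrite inE.
by apply/ffunP => i; rewrite !ffunE; apply/val_inj.
Qed.

Lemma cube_sum_single I N (u : (I -> nat) -> C) (a0 : I -> nat) :
  (forall i, a0 i < N)%N ->
  (forall a, (forall i, a i < N)%N -> a <> a0 -> u a = 0) ->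
  cube_sum N u = u a0.
Proof.
move=> a0N u0; pose b0 : {ffun I -> 'I_N} := [ffun i => Ordinal (a0N i)].
have b0E : (fun i => b0 i : nat) = a0 by apply/funext => i; rewrite ffunE.
rewrite /cube_sum (bigD1 b0)//= b0E big1 ?addr0// => a /eqP ab0.
apply: u0 => [i|aa0]; [exact: ltn_ord|apply: ab0]; apply/ffunP => i; apply/val_inj.
by rewrite /= ffunE/= -aa0.
Qed.

(** Coefficients outside the original cube are replaced by 0. The sum is then unchanged when the
    cube grows, so that several polynomials can be written over a common cube. *)
Lemma poly_fun_widen I (f : (I -> C) -> C) : poly_fun f ->
  exists (c : (I -> nat) -> C) (N : nat), forall N' z, (N <= N')%N ->
    f z = cube_sum N' (fun a => c a * monomial z a).
Proof.
move=> [c [N fE]]; exists (fun a => if `[< forall i, a i < N >]%N then c a else 0), N.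
move=> N' z NN'; rewrite fE (cube_sum_widen _ NN') big_mkcond/=.
apply: eq_bigr => a _; case: asboolP => [/forallP ->//|].
by case: forallP => // _ _; rewrite mul0r.
Qed.

Lemma poly_funD I (f g : (I -> C) -> C) :
  poly_fun f -> poly_fun g -> poly_fun (fun z => f z + g z).
Proof.
move=> /poly_fun_widen[c [N fE]] /poly_fun_widen[d [N' gE]].
exists (fun a => c a + d a), (maxn N N') => z.
rewrite (fE _ _ (leq_maxl N N')) (gE _ _ (leq_maxr N N')) -big_split/=.
by apply: eq_bigr => a _; rewrite mulrDl.
Qed.

Lemma poly_fun_monomial I (k : C) (a0 : I -> nat) :
  poly_fun (fun z => k * monomial z a0).
Proof.
exists (fun a => if `[< a = a0 >] then k else 0), (\max_i a0 i).+1 => z.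
rewrite (cube_sum_single (a0 := a0)); first by rewrite asboolT.
  by move=> i; rewrite ltnS (leq_bigmax i).
by move=> a _ aa0; rewrite asboolF// mul0r.
Qed.

Lemma poly_fun_monomial1 I (a : I -> nat) : poly_fun (fun z : I -> C => monomial z a).
Proof.
have := poly_fun_monomial 1 a; congr poly_fun.
by apply/funext => z; rewrite mul1r.
Qed.

Lemma poly_fun_cst I (k : C) : poly_fun (fun=> k : C) (I := I).
Proof.
have := poly_fun_monomial k (fun=> 0%N : nat) (I := I); congr poly_fun.
by apply/funext => z; rewrite /monomial big1 ?mulr1.
Qed.

Lemma poly_fun_var I (i : I) : poly_fun (fun z : I -> C => z i).
Proof.
have := poly_fun_monomial 1 (fun j : I => (j == i) : nat); congr poly_fun.
apply/funext => z; rewrite /monomial mul1r (bigD1 i)//= eqxx expr1 big1 ?mulr1//.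
by move=> j /negPf->.
Qed.

Lemma poly_fun_sum I (T : Type) (r : seq T) (P : pred T) (f : T -> (I -> C) -> C) :
  (forall t, poly_fun (f t)) -> poly_fun (fun z => \sum_(t <- r | P t) f t z).
Proof.
move=> fP; elim: r => [|t r IH].
  by under eq_fun do rewrite big_nil; apply: poly_fun_cst.
under eq_fun do rewrite big_cons; case: (P t) => //.
exact: poly_funD.
Qed.

Lemma poly_funM I (f g : (I -> C) -> C) :
  poly_fun f -> poly_fun g -> poly_fun (fun z => f z * g z).
Proof.
move=> [c [N fE]] [d [N' gE]].
under eq_fun do rewrite fE gE mulr_suml.
apply: poly_fun_sum => a; under eq_fun do rewrite mulr_sumr.
apply: poly_fun_sum => b.
have := poly_fun_monomial (c (fun i => a i) * d (fun i => b i)) (fun i => a i + b i)%N.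
congr poly_fun; apply/funext => z; rewrite mulrACA; congr (_ * _).
by rewrite /monomial -big_split/=; apply: eq_bigr => i _; rewrite exprD.
Qed.

Lemma poly_fun_prod I (T : Type) (r : seq T) (P : pred T) (f : T -> (I -> C) -> C) :
  (forall t, poly_fun (f t)) -> poly_fun (fun z => \prod_(t <- r | P t) f t z).
Proof.
move=> fP; elim: r => [|t r IH].
  by under eq_fun do rewrite big_nil; apply: poly_fun_cst.
by under eq_fun do rewrite big_cons; case: (P t) => //; apply: poly_funM.
Qed.

Lemma poly_funX I (f : (I -> C) -> C) n : poly_fun f -> poly_fun (fun z => f z ^+ n).
Proof.
move=> fP; elim: n => [|n IH].
  by under eq_fun do rewrite expr0; apply: poly_fun_cst.
by under eq_fun do rewrite exprS; apply: poly_funM.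
Qed.

Lemma poly_fun_comp I J (f : (I -> C) -> C) (g : I -> (J -> C) -> C) :
  poly_fun f -> (forall i, poly_fun (g i)) -> poly_fun (fun w => f (fun i => g i w)).
Proof.
move=> [c [N fE]] gP; under eq_fun do rewrite fE.
apply: poly_fun_sum => a; apply: poly_funM; first exact: poly_fun_cst.
by apply: poly_fun_prod => i; apply: poly_funX.
Qed.

Lemma poly_fun_ind I (Q : ((I -> C) -> C) -> Prop) :
  (forall k, Q (fun=> k)) -> (forall i, Q (fun z => z i)) ->
  (forall f g, Q f -> Q g -> Q (fun z => f z + g z)) ->
  (forall f g, Q f -> Q g -> Q (fun z => f z * g z)) ->
  forall f, poly_fun f -> Q f.
Proof.
move=> Qc Qv Qa Qm f [c [N fE]]; have -> : f = fun z =>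
    cube_sum N (fun a => c a * monomial z a) by apply/funext.
rewrite /cube_sum; elim: index_enum => [|a r IH].
  by under eq_fun do rewrite big_nil; apply: Qc.
under eq_fun do rewrite big_cons; apply: (Qa) => //.
apply: (Qm (fun=> _)); first exact: Qc.
rewrite /monomial; elim: (index_enum I) => [|i s IHs].
  by under eq_fun do rewrite big_nil; apply: Qc.
under eq_fun do rewrite big_cons; apply: (Qm) => //.
elim: (a i : nat) => [|n IHn]; first by under eq_fun do rewrite expr0; apply: Qc.
by under eq_fun do rewrite exprS; apply: (Qm).
Qed.

(** Bound and Lipschitz constant are carried together because the induction step for products needs
    both. *)
Lemma poly_fun_lipschitz I (f : (I -> C) -> C) (B : C) : poly_fun f ->
  exists K, [/\ 0 <= K, forall z, (forall i, `|z i| <= B) -> `|f z| <= K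
    & forall z z' d, (forall i, `|z i| <= B) -> (forall i, `|z' i| <= B) -> 0 <= d ->
      (forall i, `|z i - z' i| <= d) -> `|f z - f z'| <= K * d].
Proof.
elim/poly_fun_ind => [k|i|{}f g [K [K0 fK fL]] [K' [K'0 gK gL]]|{}f g [K [K0 fK fL]] [K' [K'0 gK gL]]].
- exists `|k|; split => // z z' d _ _ d0 _.
  by rewrite subrr normr0 mulr_ge0.
(* The summand 1 makes [K * d] at least [d]; the absolute value keeps the constant nonnegative for
   an arbitrary [B]. *)
- exists (`|B| + 1); split => [|z zB|z z' d zB _ d0 zz'].
  - exact: addr_ge0.
  - have B0 : 0 <= B := le_trans (normr_ge0 _) (zB i).
    by rewrite (le_trans (zB i))// ger0_norm// lerDl.
  - by rewrite (le_trans (zz' i))// ler_peMl// lerDr.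
- exists (K + K'); split => [|z zB|z z' d zB zB' d0 zz'].
  - exact: addr_ge0.
  - by apply: le_trans (ler_normD _ _) _; apply: lerD; [apply: fK|apply: gK].
  - rewrite opprD addrACA [leRHS]mulrDl; apply: le_trans (ler_normD _ _) _.
    by apply: lerD; [apply: fL|apply: gL].
- exists (K * K' + K * K'); split => [|z zB|z z' d zB zB' d0 zz'].
  - by rewrite addr_ge0 ?mulr_ge0.
  - by rewrite normrM (@le_trans _ _ (K * K'))// ?ler_pM ?fK ?gK// lerDl mulr_ge0.
  have -> : f z * g z - f z' * g z' = (f z - f z') * g z + f z' * (g z - g z').
    by ring.
  rewrite [leRHS]mulrDl (le_trans (ler_normD _ _))// !normrM lerD//.
    by rewrite mulrAC ler_pM ?fL ?gK.
  by rewrite -mulrA ler_pM ?fK ?gL.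
Qed.

End PolynomialFunctions.

(** * Cauchy's estimates *)

Section CubeSums.
Context {C : numClosedFieldType} {C_complete : complete_field C}.
Implicit Types I J : finType.

(** A mean value estimate for powers. It reduces the tail of the geometric series in several
    variables, a difference of powers of one-variable sums, to a one-variable tail. *)
Lemma subrX_le n (x y B : C) : 0 <= y -> y <= x -> x <= B -> 1 <= B ->
  x ^+ n - y ^+ n <= n%:R * B ^+ n * (x - y).
Proof.
move=> y0 yx xB B1; have B0 : 0 <= B := le_trans ler01 B1.
have xy0 : 0 <= x - y by rewrite subr_ge0.
elim: n => [|n IH]; first by rewrite !expr0 subrr !mul0r.
have -> : x ^+ n.+1 - y ^+ n.+1 = x * (x ^+ n - y ^+ n) + y ^+ n * (x - y).
  by rewrite !exprS; ring.
have -> : n.+1%:R * B ^+ n.+1 * (x - y)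
    = B * (n%:R * B ^+ n * (x - y)) + B ^+ n.+1 * (x - y).
  by rewrite -natr1 exprS; ring.
apply: lerD.
  apply: le_trans (ler_wpM2l B0 IH); apply: ler_wpM2r xB.
  by rewrite subr_ge0 lerXn2r ?nnegrE// (le_trans y0).
apply: ler_wpM2r => //; apply: (@le_trans _ _ (B ^+ n)).
  by rewrite lerXn2r ?nnegrE// (le_trans yx).
by rewrite exprS ler_peMl// exprn_ge0.
Qed.

Local Notation half := (2^-1 : C).

Lemma geometric_half N : \sum_(j < N) half ^+ j = 2 - 2 * half ^+ N.
Proof.
elim: N => [|N IH]; first by rewrite big_ord0 expr0 mulr1 subrr.
by rewrite big_ord_recr/= IH exprS ; field.
Qed.

Let half_ge0 n : 0 <= half ^+ n.
Proof. by rewrite exprn_ge0// invr_ge0. Qed.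

Let geometric_half_le2 N : \sum_(j < N) half ^+ j <= 2.
Proof. by rewrite geometric_half lerBlDr lerDl mulr_ge0. Qed.

Let geometric_half_ge0 N : 0 <= \sum_(j < N) half ^+ j.
Proof. by apply: sumr_ge0 => j _. Qed.

Lemma cube_sum_geometric I N :
  cube_sum N (monomial (fun=> half) (I := I)) = (\sum_(j < N) half ^+ j) ^+ #|I|.
Proof.
rewrite /monomial (cube_sum_prod N (fun (i : I) j => half ^+ j)).
by rewrite prodr_const.
Qed.

Lemma cube_sum_le I N (M : C) (u : (I -> nat) -> C) : 0 <= M ->
  (forall a, (forall i, a i < N)%N -> `|u a| <= M * monomial (fun=> half) a) ->
  `|cube_sum N u| <= M * 2 ^+ #|I|.
Proof.
move=> M0 uM; apply: (@le_trans _ _ (M * cube_sum N (monomial (fun=> half)) (I := I))).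
  rewrite /cube_sum mulr_sumr; apply: le_trans (ler_norm_sum _ _ _) _.
  by apply: ler_sum => a _; apply: uM => i.
by rewrite cube_sum_geometric ler_wpM2l// lerXn2r ?nnegrE.
Qed.

(** [N0] depends on [M] and [x] but not on [u]; this uniformity turns domination into uniform
    convergence. *)
Lemma cube_sum_tail I (M x : C) : 0 <= M -> 0 < x ->
  exists N0, forall N (u : (I -> nat) -> C), (N0 <= N)%N ->
    (forall a, `|u a| <= M * monomial (fun=> half) a) ->
    `|cube_sum N u - cube_sum N0 u| < x.
Proof.
(* The first two factors in the parentheses come from [subrX_le] for sums bounded by 2, the last 2
   from the one-variable tail 2 / 2^N0, which is at most 2 / (N0 + 1). *)
move=> M0 x0; set A := M * (#|I|%:R * 2 ^+ #|I| * 2).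
have A0 : 0 <= A by rewrite !mulr_ge0// exprn_ge0.
have A1 : 0 < A + 1 by rewrite ltr_wpDl.
have [N0 N0x] := field_archimedean (divr_gt0 x0 A1).
exists N0 => N u N0N uM.
have cubeB v : cube_sum N v - cube_sum N0 v =
    \sum_(a : {ffun I -> 'I_N} | ~~ [forall i, a i < N0]%N) v (fun i => a i : nat) :> C.
  rewrite (cube_sum_widen _ N0N) /cube_sum.
  rewrite (bigID (fun a : {ffun I -> 'I_N} => [forall i, a i < N0]%N))/=.
  by rewrite addrC addrK.
apply: (@le_lt_trans _ _ (A * N0.+1%:R^-1)); last first.
  apply: (@le_lt_trans _ _ ((A + 1) * N0.+1%:R^-1)).
    by rewrite ler_wpM2r ?invr_ge0// lerDl.
  by rewrite mulrC -ltr_pdivlMr.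
pose g : (I -> nat) -> C := monomial (fun=> half).
apply: (@le_trans _ _ (M * (cube_sum N g - cube_sum N0 g))).
  rewrite !cubeB mulr_sumr; apply: le_trans (ler_norm_sum _ _ _) _.
  by apply: ler_sum => a _; apply: uM.
rewrite /A -mulrA ler_wpM2l// !cube_sum_geometric.
apply: le_trans (subrX_le _ _ _ (geometric_half_le2 N) _) _ => //.
- rewrite !geometric_half lerD2l lerN2 ler_wpM2l//.
  by rewrite ler_wiXn2l// ?invr_ge0// invf_le1// ler1n.
- by rewrite ler1n.
rewrite -!mulrA !ler_wpM2l// ?exprn_ge0//.
rewrite !geometric_half; apply: (@le_trans _ _ (2 * half ^+ N0)).
  have -> : 2 - 2 * half ^+ N - (2 - 2 * half ^+ N0) =
    2 * half ^+ N0 - 2 * half ^+ N by ring.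
  by rewrite lerBlDr lerDl mulr_ge0.
rewrite ler_wpM2l// exprVn lef_pV2 ?posrE ?exprn_gt0// ?ltr0n//.
by rewrite -natrX ler_nat ltn_expl.
Qed.

(** In characteristic 0 the polynomial X^n - 1 is separable, so that it has n distinct roots, among
    them a primitive one. *)
Lemma prim_root_exists n : (0 < n)%N -> exists w : C, n.-primitive_root w.
Proof.
move=> n0; pose p : {poly C} := 'X^n - 1; have [r Dp] := closed_field_poly_normal p.
rewrite (monicP _) ?monicXnsubC // scale1r in Dp.
have rn1 : all n.-unity_root r by apply/allP=> z; rewrite -root_prod_XsubC -Dp.
have sz_r : (n < (size r).+1)%N by rewrite -(size_prod_XsubC r id) -Dp size_XnsubC.
have [|w] := hasP (has_prim_root n0 rn1 _ sz_r); last by exists w.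
by rewrite -separable_prod_XsubC -Dp separable_Xn_sub_1// pnatr_eq0 -lt0n.
Qed.

Lemma sum_prim_rootX n (w : C) m : n.-primitive_root w -> ~~ (n %| m)%N ->
  \sum_(j < n) w ^+ (j * m) = 0.
Proof.
move=> wn nm; have wm1 : w ^+ m - 1 != 0 by rewrite subr_eq0 -(prim_order_dvd wn).
apply: (mulfI wm1); rewrite mulr0.
under eq_bigr do rewrite mulnC exprM.
by rewrite -subrX1 exprAC (prim_expr_order wn) expr1n subrr.
Qed.

(* The coefficients are averages over tuples of roots of unity, which play the
   part of the contour integrals. *)
Lemma cauchy_estimate I N (c : (I -> nat) -> C) (r B : C) : 0 < r ->
  (forall z, (forall i, `|z i| <= r) ->
     `|cube_sum N (fun a => c a * monomial z a)| <= B) ->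
  forall a, (forall i, a i < N)%N -> `|c a| * r ^+ (\sum_i a i)%N <= B.
Proof.
move=> r0 cB a aN; have [w wn] := prim_root_exists (ltn0Sn N).
have w1 : `|w| = 1.
  apply/eqP; rewrite -(@pexpr_eq1 _ _ N.+1)//.
  by rewrite -normrX (prim_expr_order wn) normr1.
pose T : finType := {ffun I -> 'I_N.+1}.
pose z (k : T) i := r * w ^+ k i.
(* The exponent [N.+1 - a i] stands for [- a i] modulo the order of [w]. Summing against [v]
   isolates the coefficient of [a], since exponents below [N] that agree modulo [N.+1] are equal. *)
pose v (k : T) := \prod_i w ^+ (k i * (N.+1 - a i)).
have zv b : (forall i, b i < N)%N -> \sum_k monomial (z k) b * v k =
    r ^+ (\sum_i b i)%N * \prod_i \sum_(j < N.+1) w ^+ (j * (b i + (N.+1 - a i))).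
  move=> bN; rewrite bigA_distr_bigA/= mulr_sumr; apply: eq_bigr => k _.
  rewrite expr_sum -!big_split/=; apply: eq_bigr => i _.
  by rewrite /z exprMn -exprM -mulrA -exprD -mulnDr.
have avg : \sum_k cube_sum N (fun b => c b * monomial (z k) b) * v k =
    c a * r ^+ (\sum_i a i)%N * #|T|%:R.
  transitivity (\sum_(b : {ffun I -> 'I_N}) c (fun i => b i) *
      \sum_k monomial (z k) (fun i => b i) * v k).
    rewrite /cube_sum; transitivity (\sum_k \sum_(b : {ffun I -> 'I_N})
        c (fun i => b i) * (monomial (z k) (fun i => b i) * v k)).
      by apply: eq_bigr => k _; rewrite mulr_suml; apply: eq_bigr => b _; rewrite mulrA.
    by rewrite exchange_big/=; apply: eq_bigr => b _; rewrite mulr_sumr.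
  pose u b := c b * (r ^+ (\sum_i b i)%N *
    \prod_(i : I) \sum_(j < N.+1) w ^+ (j * (b i + (N.+1 - a i)))).
  transitivity (cube_sum N u).
    by apply: eq_bigr => b _; rewrite /u zv// => i; apply: ltn_ord.
  rewrite (cube_sum_single aN) => [|b bN ba].
    rewrite /u mulrA; congr (_ * _); rewrite -sumr_const.
    transitivity (\prod_(i : I) \sum_(j < N.+1) (1 : C)); last first.
      by rewrite bigA_distr_bigA/=; apply: eq_bigr => k _; rewrite big1.
    apply: eq_bigr => i _; apply: eq_bigr => j _.
    by rewrite subnKC ?(ltnW (ltn_trans (aN i) _))// mulnC exprM (prim_expr_order wn) expr1n.
  rewrite /u; have [i abi] : exists i, b i <> a i.
    by apply/existsNP => ab; apply: ba; apply/funext.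
  rewrite (_ : \prod_(_ : I) _ = 0) ?mulr0//.
  rewrite (bigD1 i)//= (sum_prim_rootX wn) ?mul0r//.
  apply/negP => /dvdnP[q] Eq; apply: abi; move: Eq (aN i) (bN i).
  by case: q => [|[|q]]; rewrite ?mulSn; lia.
have T0 : 0 < #|T|%:R :> C.
  by rewrite ltr0n card_ffun expn_gt0 card_ord.
rewrite -(ler_pM2r T0); apply: (@le_trans _ _ `|c a * r ^+ (\sum_i a i)%N * #|T|%:R|).
  by rewrite !normrM normrX normr_nat (gtr0_norm r0).
rewrite -avg; apply: le_trans (ler_norm_sum _ _ _) _.
rewrite mulr_natr -sumr_const; apply: ler_sum => k _.
have -> : B = B * 1 by rewrite mulr1.
rewrite normrM; apply: ler_pM => //.
  by apply: cB => i; rewrite /z normrM normrX w1 expr1n mulr1 gtr0_norm.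
by rewrite /v normr_prod big1// => i _; rewrite normrX w1 expr1n.
Qed.

End CubeSums.

(** * Analytic functions as uniform limits of polynomials *)

Section Analytic.
Context {C : numClosedFieldType} {C_complete : complete_field C}.
Implicit Types I J : finType.

Local Notation half := (2^-1 : C).

Definition poly_approximable I (f : (I -> C) -> C) (z0 : I -> C) : Prop :=
  exists U, nbhs z0 U /\ forall x : C, 0 < x ->
    exists2 P, poly_fun P & forall z, U z -> `|f z - P z| < x.

(* Weierstrass test for the series obtained from a power series by putting the
   polynomials [L a] in place of the monomials. *)
Lemma poly_series_approximable I J (c : (I -> nat) -> C) (M : C)
    (L : (I -> nat) -> (J -> C) -> C) (w0 : J -> C) (U : set (J -> C)) :
  0 <= M -> nbhs w0 U -> (forall a, poly_fun (L a)) ->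
  (forall a w, U w -> `|c a * L a w| <= M * monomial (fun=> half) a) ->
  exists2 g, poly_approximable g w0 & forall w x, U w -> 0 < x ->
    exists N0, forall N, (N0 <= N)%N ->
      `|cube_sum N (fun a => c a * L a w) - g w| < x.
Proof.
move=> M0 nU Lpoly LM.
pose S w N := cube_sum N (fun a => c a * L a w).
have Scauchy x : 0 < x -> exists N0, forall N w, U w -> (N0 <= N)%N ->
    `|S w N - S w N0| < x.
  move=> x0; have [N0 N0P] := cube_sum_tail I M0 x0.
  by exists N0 => N w Uw NN; apply: N0P => // a; apply: LM.
have lim w : exists l, U w -> forall x : C, 0 < x -> exists N0, forall N,
    (N0 <= N)%N -> `|S w N - l| < x.
  have [Uw|nUw] := pselect (U w); last by exists 0.
  have [|l lP] := field_cauchy_complete (u := S w); last by exists l.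
  move=> x x0; have x20 : 0 < x / 2 by rewrite divr_gt0.
  have [N0 N0P] := Scauchy _ x20; exists N0 => m n mN nN.
  have -> : S w m - S w n = (S w m - S w N0) - (S w n - S w N0) by ring.
  apply: le_lt_trans (ler_normB _ _) _.
  by rewrite [ltRHS](splitr x) ltrD// N0P.
have /choice[g gP] := lim.
exists g => [|w x Uw x0]; last exact: gP.
exists U; split=> // x x0; have x20 : 0 < x / 2 by rewrite divr_gt0.
have [N0 N0P] := Scauchy _ x20; exists (fun w => S w N0).
  apply: poly_fun_sum => a; apply: poly_funM; first exact: poly_fun_cst.
  exact: Lpoly.
move=> w Uw; have [N1 N1P] := gP w Uw _ x20.
have := N0P (maxn N0 N1) w Uw (leq_maxl _ _); have := N1P _ (leq_maxr N0 N1).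
move=> gN SN; rewrite -(subrKA (S w (maxn N0 N1))).
apply: le_lt_trans (ler_normD _ _) _; rewrite [ltRHS](splitr x).
by apply: ltrD SN; rewrite distrC.
Qed.

Lemma norm_monomial_le I (z : I -> C) r a : (forall i, `|z i| <= r) ->
  `|monomial z a| <= r ^+ (\sum_i a i)%N.
Proof.
move=> zr; rewrite /monomial normr_prod expr_sum; apply: ler_prod => i _.
by rewrite normrX exprn_ge0//= lerXn2r ?nnegrE// (le_trans _ (zr i)).
Qed.

(** Halving the radius of a polydisc turns a bound on the coefficients into domination by a
    geometric series. *)
Lemma monomial_half I (r : C) (a : I -> nat) :
  (r / 2) ^+ (\sum_i a i)%N = r ^+ (\sum_i a i)%N * monomial (fun=> half) a.
Proof. by rewrite exprMn expr_sum expr_sum. Qed.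

Lemma monomial_half_ge0 I (a : I -> nat) : 0 <= monomial (fun=> half) a.
Proof. by apply: prodr_ge0 => i _; rewrite exprn_ge0// invr_ge0. Qed.

Lemma near_polydisc I (z0 : I -> C) r : 0 < r ->
  \forall z \near z0, forall i, `|z i - z0 i| < r.
Proof. by move=> r0; apply/near_ballP; exists r. Qed.

Lemma cvg_eventually (u : nat -> C) l : u @ \oo --> l <->
  forall x : C, 0 < x -> exists N0, forall N, (N0 <= N)%N -> `|u N - l| < x.
Proof.
split=> [ul x x0|ul]; first have /cvgrPdist_lt/(_ x x0)[N0 _ N0P] := ul.
  by exists N0 => N NN; rewrite distrC; apply: N0P.
apply/cvgrPdist_lt => x x0; have [N0 N0P] := ul x x0.
by exists N0 => // N NN; rewrite distrC; apply: N0P.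
Qed.

Lemma limit_unique (u : nat -> C) l l' :
  (forall x : C, 0 < x -> exists N0, forall N, (N0 <= N)%N -> `|u N - l| < x) ->
  (forall x : C, 0 < x -> exists N0, forall N, (N0 <= N)%N -> `|u N - l'| < x) ->
  l = l'.
Proof.
move=> ul ul'; apply/eqP; rewrite -subr_eq0 -normr_le0; apply/negPn/negP => n0.
have d0 : 0 < `|l - l'| by rewrite normr_gt0 -normr_le0.
have d20 : 0 < `|l - l'| / 2 by rewrite divr_gt0.
have [N NP] := ul _ d20; have [N' N'P] := ul' _ d20.
have := NP _ (leq_maxl N N'); have := N'P _ (leq_maxr N N').
set m := maxn _ _ => h' h; have := ltrD h h'; rewrite -splitr.
rewrite distrC => h''; have := le_lt_trans (ler_normD _ _) h''.
by rewrite subrKA ltxx.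
Qed.

Lemma analytic_poly_approximable I (f : (I -> C) -> C) z0 :
  analytic_at f z0 -> poly_approximable f z0.
Proof.
move=> [c [r [M [r0 cM fE]]]].
have M0 : 0 <= M by apply: le_trans (cM (fun=> 0%N)); rewrite mulr_ge0// exprn_ge0 ?ltW.
have r20 : 0 < r / 2 by rewrite divr_gt0.
have rr : r / 2 <= r by rewrite ler_pdivrMr// ler_peMr ?ler1n// ltW.
pose L a (z : I -> C) := monomial (fun i => z i - z0 i) a.
have [|||g gP fg] := @poly_series_approximable _ _ c M L z0
    [set z | forall i, `|z i - z0 i| < r / 2] M0.
- exact: near_polydisc.
- move=> a; apply: (@poly_fun_comp _ I I (fun z => monomial z a)).
    exact: poly_fun_monomial1.
  by move=> i; apply: poly_funD; [exact: poly_fun_var|exact: poly_fun_cst].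
- move=> a w wr; rewrite normrM; apply: (@le_trans _ _ (`|c a| * (r / 2) ^+ (\sum_i a i)%N)).
    by rewrite ler_wpM2l// norm_monomial_le// => i; rewrite ltW.
  by rewrite monomial_half mulrA ler_wpM2r// monomial_half_ge0.
move: gP => [V [nV gP]]; exists (V `&` [set z | forall i, `|z i - z0 i| < r / 2]).
split=> [|x x0]; first by apply: filterI => //; apply: near_polydisc.
have [P Ppoly PP] := gP x x0; exists P => // z [Vz zr].
suff -> : f z = g z by apply: PP.
apply: (limit_unique _ (fg z ^~ zr)); apply/cvg_eventually; apply: fE => i.
exact: lt_le_trans (zr i) rr.
Qed.

Lemma poly_fun_shift I (P : (I -> C) -> C) (z0 : I -> C) : poly_fun P ->
  poly_fun (fun z => P (fun i => z0 i + z i)).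
Proof.
move=> PP; apply: (@poly_fun_comp _ I I P _ PP) => i.
by apply: poly_funD; [exact: poly_fun_cst|exact: poly_fun_var].
Qed.

Lemma exists_cube_bound I (a : I -> nat) N :
  exists2 N', (N <= N')%N & forall i, (a i < N')%N.
Proof.
exists (maxn N (\max_i a i).+1) => [|i]; first exact: leq_maxl.
by rewrite leq_max ltnS (leq_bigmax i) orbT.
Qed.

Lemma invS_le (m n : nat) : (n <= m)%N -> m.+1%:R^-1 <= n.+1%:R^-1 :> C.
Proof. by move=> nm; rewrite lef_pV2 ?posrE ?ltr0n// ler_nat. Qed.

(** By Cauchy's estimates, uniform closeness of the approximants bounds the differences of their
    coefficients. Hence every coefficient converges, and the limits are the coefficients of the
    power series of [f] on a smaller polydisc. *)
Lemma poly_approximable_analytic I (f : (I -> C) -> C) z0 :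
  poly_approximable f z0 -> analytic_at f z0.
Proof.
move=> [U [/near_ballP[d d0 dU] fU]].
have invS_gt0 (n : nat) : 0 < n.+1%:R^-1 :> C by rewrite invr_gt0 ltr0n.
pose r := d / 2; have r0 : 0 < r by rewrite divr_gt0.
have rd : r < d by rewrite ltr_pdivrMr// ltr_pMr// ltr1n.
have inU z : (forall i, `|z i| <= r) -> U (fun i => z0 i + z i).
  by move=> zr; apply: dU => i; rewrite addrC addKr (le_lt_trans (zr i)).
have /choice[P PP] : forall n, exists P, poly_fun P /\ forall z, U z ->
    `|f z - P z| < n.+1%:R^-1.
  by move=> n; have [P ? ?] := fU _ (invS_gt0 n); exists P.
have PW n := poly_fun_widen (poly_fun_shift z0 (PP n).1).
have /choice[c /choice[N cP0]] := PW.
have cP n N' z : (N n <= N')%N ->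
    P n (fun i => z0 i + z i) = cube_sum N' (fun a => c n a * monomial z a).
  exact: cP0.
have cC a m n : `|c m a - c n a| * r ^+ (\sum_i a i)%N <= m.+1%:R^-1 + n.+1%:R^-1.
  have [N' N'N aN'] := exists_cube_bound a (maxn (N m) (N n)).
  move: N'N; rewrite geq_max => /andP[mN' nN'].
  apply: (cauchy_estimate (N := N') (c := fun a => c m a - c n a)) => // z zr.
  have -> : cube_sum N' (fun a => (c m a - c n a) * monomial z a) =
      P m (fun i => z0 i + z i) - P n (fun i => z0 i + z i).
    rewrite !(cP _ N')// /cube_sum -sumrB.
    by apply: eq_bigr => b _; rewrite mulrBl.
  rewrite -(subrKA (f (fun i => z0 i + z i))); apply: le_trans (ler_normD _ _) _.
  apply: lerD; last by apply/ltW/(PP n).2/inU.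
  by rewrite distrC; apply/ltW/(PP m).2/inU.
have rX0 k : 0 < r ^+ k by rewrite exprn_gt0.
have lim a : exists l, forall x : C, 0 < x -> exists N', forall n, (N' <= n)%N ->
    `|c n a - l| < x.
  apply: field_cauchy_complete => x x0; set R := r ^+ (\sum_i a i)%N.
  have R0 : 0 < x * R / 2 by rewrite divr_gt0// mulr_gt0// rX0.
  have [N' N'x] := field_archimedean R0.
  exists N' => m n /invS_le mN' /invS_le nN'; rewrite -(ltr_pM2r (rX0 (\sum_i a i)%N)).
  apply: le_lt_trans (cC a m n) _; rewrite [ltRHS](splitr (x * R)).
  by apply: ltrD; [apply: le_lt_trans mN' _|apply: le_lt_trans nN' _].
have /choice[l lP] := lim.
(* One of the three terms comes from choosing [m] close to the limit, the other two from [cC], as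
   [m] is at least [n]. *)
have cl a n : `|l a - c n a| * r ^+ (\sum_i a i)%N <= 3 * n.+1%:R^-1.
  have := lP a (n.+1%:R^-1 / r ^+ (\sum_i a i)%N); rewrite divr_gt0// => /(_ isT).
  move=> [N' N'P]; have := N'P (maxn N' n) (leq_maxl _ _); set m := maxn _ _ => ml.
  have -> : 3 * n.+1%:R^-1 = n.+1%:R^-1 + (n.+1%:R^-1 + n.+1%:R^-1) :> C by ring.
  rewrite -(subrKA (c m a)); apply: (@le_trans _ _
    ((`|l a - c m a| + `|c m a - c n a|) * r ^+ (\sum_i a i)%N)).
    by rewrite ler_wpM2r ?ler_normD// ltW.
  rewrite mulrDl lerD//; first by rewrite distrC -ler_pdivlMr// ltW.
  by apply: le_trans (cC a m n) _; rewrite lerD2r invS_le ?leq_maxr.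
have [B [_ PB _]] := poly_fun_lipschitz r (poly_fun_shift z0 (PP 0%N).1).
have lM a : `|l a| * r ^+ (\sum_i a i)%N <= 3 + B.
  rewrite -(subrK (c 0%N a) (l a)); apply: (@le_trans _ _
    ((`|l a - c 0%N a| + `|c 0%N a|) * r ^+ (\sum_i a i)%N)).
    by rewrite ler_wpM2r ?ler_normD// ltW.
  rewrite mulrDl lerD//.
    by have := cl a 0%N; rewrite invr1 mulr1.
  have [N' N0 aN'] := exists_cube_bound a (N 0%N).
  by apply: (cauchy_estimate (N := N')) => // z zr; rewrite -cP//; apply: PB.
have r20 : 0 < r / 2 by rewrite divr_gt0.
have rr : r / 2 <= r by rewrite ler_pdivrMr// ler_peMr ?ler1n// ltW.
exists l, (r / 2), (3 + B); split=> // [a|z zr].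
  apply: le_trans (lM a); rewrite ler_wpM2l// lerXn2r// ?nnegrE ltW//.
(* The first summand of [K] bounds the series of the coefficient errors [l a - c n a], the second
   the distance from [P n] to [f]. *)
apply/cvg_eventually => x x0; pose K : C := 3 * 2 ^+ #|I| + 1.
have K0 : 0 < K by rewrite ltr_wpDl// mulr_ge0// exprn_ge0.
have [n nx] := field_archimedean (divr_gt0 x0 K0).
have zr' i : `|z i - z0 i| <= r / 2 by rewrite ltW.
have zU : U z.
  have -> : z = fun i => z0 i + (z i - z0 i) by apply/funext => i; rewrite addrC subrK.
  by apply: inU => i; apply: le_trans (zr' i) rr.
exists (N n) => N' NN'.
rewrite -[X in `|X - _|]/(cube_sum N' (fun a => l a * monomial (fun i => z i - z0 i) a)).
have -> : cube_sum N' (fun a => l a * monomial (fun i => z i - z0 i) a) =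
    cube_sum N' (fun a => (l a - c n a) * monomial (fun i => z i - z0 i) a)
    + P n z.
  have -> : P n z = P n (fun i => z0 i + (z i - z0 i)).
    by congr (P n); apply/funext => i; rewrite addrC subrK.
  rewrite (cP _ N')// /cube_sum -big_split/=.
  by apply: eq_bigr => a _; rewrite -mulrDl subrK.
rewrite -addrA; apply: (@le_lt_trans _ _ (3 * n.+1%:R^-1 * 2 ^+ #|I| + n.+1%:R^-1)).
  apply: le_trans (ler_normD _ _) _; apply: lerD; last first.
    by rewrite distrC; apply/ltW/(PP n).2.
  apply: cube_sum_le => [|a _]; first by rewrite mulr_ge0// ltW.
  rewrite normrM; apply: (@le_trans _ _ (`|l a - c n a| * (r / 2) ^+ (\sum_i a i)%N)).
    by rewrite ler_wpM2l// norm_monomial_le.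
  by rewrite monomial_half mulrA ler_wpM2r ?monomial_half_ge0.
have -> : 3 * n.+1%:R^-1 * 2 ^+ #|I| + n.+1%:R^-1 = n.+1%:R^-1 * K.
  by rewrite /K mulrDr mulr1 mulrCA mulrA.
by rewrite -ltr_pdivlMr.
Qed.

Lemma analytic_atP I (f : (I -> C) -> C) z0 :
  analytic_at f z0 <-> poly_approximable f z0.
Proof.
by split; [exact: analytic_poly_approximable|exact: poly_approximable_analytic].
Qed.

Lemma norm_nbhs_bounded I (z0 : I -> C) :
  exists B, \forall z \near z0, forall i, `|z i| <= B.
Proof.
exists (\sum_i `|z0 i| + 1); apply/near_ballP; exists 1 => // z z1 i.
rewrite -(subrK (z0 i) (z i)) addrC; apply: le_trans (ler_normD _ _) _.
apply: lerD; last exact/ltW/z1.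
by rewrite (bigD1 i)//= lerDl sumr_ge0.
Qed.

Lemma analytic_continuous I (f : (I -> C) -> C) z0 x :
  analytic_at f z0 -> 0 < x -> \forall z \near z0, `|f z - f z0| < x.
Proof.
move=> /analytic_atP[U [nU fU]] x0; have x30 : 0 < x / 3 by rewrite divr_gt0.
have [P Ppoly PP] := fU _ x30; have [B nB] := norm_nbhs_bounded z0.
have [K [K0 _ PK]] := poly_fun_lipschitz B Ppoly.
have K1 : 0 < K + 1 by rewrite ltr_wpDl.
have d0 : 0 < x / 3 / (K + 1) by rewrite divr_gt0.
have Uz0 := nbhs_singleton nU; have Bz0 := nbhs_singleton nB.
apply: filterS (filterI (filterI nU nB) (near_polydisc z0 d0)) => z [[Uz Bz] dz].
have -> : f z - f z0 = (f z - P z) + ((P z - P z0) + (P z0 - f z0)) by ring.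
have -> : x = x / 3 + (x / 3 + x / 3) by field.
apply: le_lt_trans (ler_normD _ _) _; apply: ltr_leD; first exact: PP.
apply: le_trans (ler_normD _ _) _; apply: lerD; last first.
  by rewrite distrC; apply/ltW/PP.
have := PK z z0 _ Bz Bz0 (ltW d0) (fun i => ltW (dz i)); move=> PKz.
apply: le_trans PKz _; rewrite mulrCA ler_piMr ?(ltW x30)//.
by rewrite ler_pdivrMr// mul1r lerDl.
Qed.

Lemma near_comp I J (g : I -> (J -> C) -> C) (z0 : I -> C) (w0 : J -> C)
    (Q : (I -> C) -> Prop) :
  (forall i, analytic_at (g i) w0) -> (forall i, g i w0 = z0 i) ->
  (\forall z \near z0, Q z) -> \forall w \near w0, Q (fun i => g i w).
Proof.
move=> ga gz /near_ballP[d d0 dQ].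
have nd : \forall w \near w0, forall i, `|g i w - z0 i| < d.
  apply: (@filter_forall _ I (fun i w => `|g i w - z0 i| < d) (nbhs w0)) => i.
  by rewrite -gz; apply: analytic_continuous.
by apply: filterS nd => w wd; apply: dQ.
Qed.

(** Approximants of [f] are composed with approximants of the [g i]. The former are Lipschitz on the
    polydisc of radius [B + 1], which contains the values of the latter once these are within 1 of
    the [g i]. *)
Lemma analytic_comp I J (f : (I -> C) -> C) (g : I -> (J -> C) -> C)
    (z0 : I -> C) (w0 : J -> C) :
  analytic_at f z0 -> (forall i, analytic_at (g i) w0) ->
  (forall i, g i w0 = z0 i) -> analytic_at (fun w => f (fun i => g i w)) w0.
Proof.
move=> /analytic_atP[U [nU fU]] ga gz; apply/analytic_atP.
have [B nB] := norm_nbhs_bounded z0.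
have /choice[V VP] : forall i, exists V, nbhs w0 V /\ forall x, 0 < x ->
    exists2 P, poly_fun P & forall w, V w -> `|g i w - P w| < x.
  by move=> i; have /analytic_atP := ga i.
have nV : \forall w \near w0, forall i, V i w.
  by apply: (@filter_forall _ I V (nbhs w0)) => i; apply: (VP i).1.
exists [set w | (forall i, V i w) /\ U (fun i => g i w) /\ forall i, `|g i w| <= B].
split.
  apply: filterI nV _; apply: filterI; first exact: (near_comp ga gz nU).
  exact: (near_comp ga gz nB).
move=> x x0; have x20 : 0 < x / 2 by rewrite divr_gt0.
have [P Ppoly PP] := fU _ x20.
have [K [K0 _ PK]] := poly_fun_lipschitz (B + 1) Ppoly.
have K1 : 0 < K + 1 by rewrite ltr_wpDl.
have D0 : 0 < x / 2 + (K + 1) by rewrite addr_gt0.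
(* [d] is smaller than both [1] and [x / 2 / (K + 1)] *)
pose d := x / 2 / (x / 2 + (K + 1)).
have d0 : 0 < d by rewrite divr_gt0.
have d1 : d <= 1 by rewrite ler_pdivrMr// mul1r lerDl ltW.
have dK : K * d <= x / 2.
  rewrite mulrCA ler_piMr ?(ltW x20)// ler_pdivrMr// mul1r.
  by rewrite addrCA lerDl addr_ge0// ltW.
have /choice[Q QP] : forall i, exists Q, poly_fun Q /\ forall w, V i w ->
    `|g i w - Q w| < d.
  by move=> i; have [Q ? ?] := (VP i).2 _ d0; exists Q.
exists (fun w => P (fun i => Q i w)).
  by apply: poly_fun_comp => // i; apply: (QP i).1.
move=> w [Vw [Uw Bw]]; rewrite -(subrKA (P (fun i => g i w))) [ltRHS](splitr x).
apply: le_lt_trans (ler_normD _ _) _; apply: ltr_leD; first exact: PP.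
apply: le_trans dK; apply: PK => [i|i||i].
- by apply: le_trans (Bw i) _; rewrite lerDl.
- rewrite -(subrK (g i w) (Q i w)) addrC; apply: le_trans (ler_normD _ _) _.
  by apply: lerD => //; rewrite distrC; apply/ltW/(lt_le_trans _ d1)/(QP i).2.
- exact: ltW.
- by apply/ltW/(QP i).2.
Qed.

Lemma poly_analytic I (f : (I -> C) -> C) z0 : poly_fun f -> analytic_at f z0.
Proof.
move=> fP; apply/analytic_atP; exists setT; split; first exact: filterT.
by move=> x x0; exists f => // z _; rewrite subrr normr0.
Qed.

End Analytic.

(** * Divided differences and primitives *)

Section DividedDifferences.
Context {C : numClosedFieldType} {C_complete : complete_field C}.
Variables (I : finType) (v : I) (z0 : I -> C).

(* The point [z] together with a second value of the variable [v]. *)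
Definition with_second (z : I -> C) (t : C) (o : option I) : C := oapp z t o.

Definition set_var (z : I -> C) (t : C) (i : I) : C := if i == v then t else z i.

(** A monomial centred at [z0] in which the power of the variable [v] gives way to a function [q] of
    two values of that variable; divided differences and primitives are both obtained from series of
    such terms. *)
Definition series_term (q : nat -> C -> C -> C) (a : I -> nat) (w : option I -> C) : C :=
  q (a v) (w (Some v) - z0 v) (w None - z0 v)
  * \prod_(i | i != v) (w (Some i) - z0 i) ^+ a i.

Lemma monomial_set_var z t a :
  monomial (fun i => set_var z t i - z0 i) a =
  (t - z0 v) ^+ a v * \prod_(i | i != v) (z i - z0 i) ^+ a i.
Proof.
rewrite /monomial (bigD1 v)//= /set_var eqxx; congr (_ * _).
by apply: eq_bigr => i /negPf->.
Qed.

Lemma set_var_id z : set_var z (z v) = z.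
Proof. by apply/funext => i; rewrite /set_var; case: eqP => [->|]. Qed.

(** Three radii occur: the coefficients are bounded at [r], [r / 2] gives domination by a geometric
    series, and the points stay within [r / 4], which leaves a factor 2^n of room for the growth of
    [q n]. *)
Lemma term_series_analytic (q : nat -> C -> C -> C) (c : (I -> nat) -> C) (r M B : C) :
  0 < r -> 0 <= M -> 0 <= B ->
  (forall a, `|c a| * r ^+ (\sum_i a i)%N <= M) ->
  (forall n, poly_fun (fun w : option I -> C =>
     q n (w (Some v) - z0 v) (w None - z0 v))) ->
  (forall n s t, `|s| <= r / 4 -> `|t| <= r / 4 -> `|q n s t| <= B * (r / 2) ^+ n) ->
  exists2 g, analytic_at g (with_second z0 (z0 v)) &
    \forall w \near with_second z0 (z0 v),
      (fun N => cube_sum N (fun a => c a * series_term q a w)) @ \oo --> g w.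
Proof.
move=> r0 M0 B0 cM qpoly qB.
have r40 : 0 < r / 4 by rewrite divr_gt0.
have r42 : r / 4 <= r / 2 by rewrite ler_wpM2l ?(ltW r0)// lef_pV2 ?posrE// ler_nat.
pose U := [set w : option I -> C | forall o, `|w o - with_second z0 (z0 v) o| < r / 4].
have nU : nbhs (with_second z0 (z0 v)) U := near_polydisc _ r40.
have [a|a w Uw|g gP gE] := @poly_series_approximable _ _ I _ c (M * B) (series_term q)
    (with_second z0 (z0 v)) U (mulr_ge0 M0 B0) nU.
- apply: poly_funM => //; apply: poly_fun_prod => i; apply: poly_funX.
  by apply: poly_funD; [exact: poly_fun_var|exact: poly_fun_cst].
- rewrite normrM; apply: (@le_trans _ _ (`|c a| * (B * (r / 2) ^+ (\sum_i a i)%N))).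
    rewrite ler_wpM2l// /series_term normrM expr_sum [X in _ <= _ * X](bigD1 v)//= mulrA.
    apply: ler_pM => //.
      by apply: qB; apply: ltW; [apply: (Uw (Some v))|apply: (Uw None)].
    rewrite normr_prod; apply: ler_prod => i _.
    rewrite normrX exprn_ge0//= lerXn2r ?nnegrE// ?divr_ge0 ?(ltW r0)//.
    exact: le_trans (ltW (Uw (Some i))) r42.
  rewrite monomial_half; set m := monomial _ _; set R := r ^+ _.
  have -> : `|c a| * (B * (R * m)) = `|c a| * R * B * m by ring.
  by rewrite !ler_wpM2r ?monomial_half_ge0.
exists g; first exact/analytic_atP.
by apply: filterS nU => w Uw; apply/cvg_eventually => x x0; apply: gE.
Qed.

(** The quotient (t^n - s^n) / (t - s) without the division, hence meaningful at s = t as well. *)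
Definition slope n (s t : C) : C := \sum_(j < n) t ^+ (n.-1 - j) * s ^+ j.

Lemma slope_poly n :
  poly_fun (fun w : option I -> C => slope n (w (Some v) - z0 v) (w None - z0 v)).
Proof.
apply: poly_fun_sum => j; apply: poly_funM; apply: poly_funX;
  by apply: poly_funD; [exact: poly_fun_var|exact: poly_fun_cst].
Qed.

Lemma slope_le n s t r : `|s| <= r -> `|t| <= r -> `|slope n s t| <= n%:R * r ^+ n.-1.
Proof.
move=> sr tr; have r0 : 0 <= r := le_trans (normr_ge0 _) sr.
apply: le_trans (ler_norm_sum _ _ _) _.
rewrite mulr_natl -[X in _ *+ X]card_ord -sumr_const; apply: ler_sum => j _.
have {2}-> : n.-1 = (n.-1 - j + j)%N by rewrite subnK//; case: n j => [[]|n j] //=; rewrite -ltnS.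
rewrite exprD normrM !normrX; apply: ler_pM; rewrite ?exprn_ge0// lerXn2r ?nnegrE//.
Qed.

Lemma near_series (f : (I -> C) -> C) (c : (I -> nat) -> C) r : 0 < r ->
  (forall z, (forall i, `|z i - z0 i| < r) ->
    (fun N => cube_sum N (fun a => c a * monomial (fun i => z i - z0 i) a)) @ \oo
      --> f z) ->
  \forall w \near with_second z0 (z0 v), forall z, (forall i, z i = w (Some i)) ->
    (fun N => cube_sum N (fun a => c a * monomial (fun i => z i - z0 i) a)) @ \oo
      --> f z /\
    (fun N => cube_sum N (fun a => c a *
       monomial (fun i => set_var z (w None) i - z0 i) a)) @ \oo
      --> f (set_var z (w None)).
Proof.
move=> r0 fE; apply: filterS (near_polydisc _ r0) => w wr z zw; split; apply: fE => i.
  by rewrite zw; apply: (wr (Some i)).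
rewrite /set_var; case: eqP => [->|_]; first exact: (wr None).
by rewrite zw; apply: (wr (Some i)).
Qed.

Lemma divided_difference (f : (I -> C) -> C) : analytic_at f z0 ->
  exists2 k, analytic_at k (with_second z0 (z0 v)) &
    \forall w \near with_second z0 (z0 v), forall z, (forall i, z i = w (Some i)) ->
      f (set_var z (w None)) - f z = (w None - z v) * k w.
Proof.
move=> [c [r [M [r0 cM fE]]]].
have M0 : 0 <= M by apply: le_trans (cM (fun=> 0%N)); rewrite mulr_ge0// exprn_ge0 ?ltW.
have r40 : 0 < r / 4 by rewrite divr_gt0.
(* The constant [4 / r] comes from n (r/4)^(n-1) <= 2^n (r/4)^(n-1) = (4/r) (r/2)^n. *)
have [||k ka kE] := @term_series_analytic slope c r M (4 / r) r0 M0 _ cM slope_poly.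
- by rewrite divr_ge0 ?ltW.
- move=> n s t sr tr; apply: le_trans (slope_le n sr tr) _.
  case: n => [|n]; first by rewrite mul0r mulr_ge0 ?divr_ge0 ?exprn_ge0 ?ltW// divr_gt0.
  have -> : (r / 2) ^+ n.+1 = (r / 4) ^+ n.+1 * 2 ^+ n.+1.
    by rewrite -exprMn; congr (_ ^+ _); field.
  have -> : 4 / r * ((r / 4) ^+ n.+1 * 2 ^+ n.+1) = 2 ^+ n.+1 * (r / 4) ^+ n.
    by rewrite exprS; field; rewrite gt_eqF.
  apply: ler_wpM2r; first by rewrite exprn_ge0// ltW.
  by rewrite -[2]/(2%:R) -natrX ler_nat ltnW// ltn_expl.
exists k => //; apply: filterS (filterI kE (near_series r0 fE)) => w [kw fw] z zw.
have [f1 f2] := fw z zw.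
pose S1 N := cube_sum N (fun a => c a * monomial (fun i => z i - z0 i) a).
pose S2 N := cube_sum N (fun a => c a *
  monomial (fun i => set_var z (w None) i - z0 i) a).
pose K N := cube_sum N (fun a => c a * series_term slope a w).
have f21 : (fun N => S2 N - S1 N) @ \oo --> f (set_var z (w None)) - f z.
  exact: cvgB f2 f1.
have lk : (fun N => (w None - z v) * K N) @ \oo --> (w None - z v) * k w.
  exact: cvgM (cvg_cst _) kw.
suff E : (fun N => S2 N - S1 N) = (fun N => (w None - z v) * K N).
  rewrite E in f21.
  exact: limit_unique ((cvg_eventually _ _).1 f21) ((cvg_eventually _ _).1 lk).
apply/funext => N; rewrite /S1 /S2 /K /cube_sum mulr_sumr -sumrB.
apply: eq_bigr => a _.
rewrite -mulrBr mulrCA; congr (_ * _).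
rewrite monomial_set_var -{2}[z]set_var_id monomial_set_var -mulrBl subrXX.
rewrite /series_term /slope -zw mulrA; congr (_ * _ * _).
  by rewrite opprB addrA subrK.
by apply: eq_bigr => i _; rewrite zw.
Qed.

Lemma analytic_with_second (g : (option I -> C) -> C) (z1 : I -> C) (t : (I -> C) -> C) :
  analytic_at g (with_second z1 (t z1)) -> analytic_at t z1 ->
  analytic_at (fun z => g (with_second z (t z))) z1.
Proof.
move=> ga ta; pose h (o : option I) z := with_second z (t z) o.
have ha o : analytic_at (h o) z1 by case: o => [i|//]; apply/poly_analytic/poly_fun_var.
exact: (analytic_comp (g := h) ga ha).
Qed.

Lemma near_with_second (Q : (option I -> C) -> Prop) (z1 : I -> C) (t : (I -> C) -> C) :
  (\forall w \near with_second z1 (t z1), Q w) -> analytic_at t z1 ->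
  \forall z \near z1, Q (with_second z (t z)).
Proof.
move=> nQ ta; pose h (o : option I) z := with_second z (t z) o.
have ha o : analytic_at (h o) z1 by case: o => [i|//]; apply/poly_analytic/poly_fun_var.
exact: (near_comp (g := h) ha _ nQ).
Qed.

(* [k] is the divided difference of the primitive, the primitive itself being
   its value on the segment from the centre. *)
Lemma primitive (p : (I -> C) -> C) : analytic_at p z0 ->
  exists W k, [/\ analytic_at W z0, analytic_at k (with_second z0 (z0 v)),
    \forall w \near with_second z0 (z0 v), forall z, (forall i, z i = w (Some i)) ->
      W (set_var z (w None)) - W z = (w None - z v) * k w &
    \forall z \near z0, k (with_second z (z v)) = p z].
Proof.
move=> [c [r [M [r0 cM fE]]]].
have M0 : 0 <= M by apply: le_trans (cM (fun=> 0%N)); rewrite mulr_ge0// exprn_ge0 ?ltW.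
(* The divided difference of the primitive t^(n+1) / (n+1) of t^n; the denominator cancels the
   factor n+1 of [slope_le]. *)
pose q n s t := n.+1%:R^-1 * slope n.+1 s t.
have r40 : 0 < r / 4 by rewrite divr_gt0.
have n1 n : 0 < n.+1%:R :> C by rewrite ltr0n.
have [n|n s t sr tr|k ka kE] := @term_series_analytic q c r M 1 r0 M0 ler01 cM.
- by apply: poly_funM; [exact: poly_fun_cst|exact: slope_poly].
- rewrite /q normrM gtr0_norm ?invr_gt0// ler_pdivrMl// mul1r.
  apply: le_trans (slope_le _ sr tr) _; apply: ler_wpM2l; first exact: ltW.
  rewrite /= lerXn2r ?nnegrE ?divr_ge0 ?(ltW r0)//.
  by rewrite ler_wpM2l ?(ltW r0)// lef_pV2 ?posrE// ler_nat.
have var_an : analytic_at (fun z : I -> C => z v) z0.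
  exact/poly_analytic/poly_fun_var.
have cst_an : analytic_at (fun _ : I -> C => z0 v) z0.
  exact/poly_analytic/poly_fun_cst.
pose W z := (z v - z0 v) * k (with_second z (z0 v)).
have Wa : analytic_at W z0.
  pose g (b : bool) z := if b then z v - z0 v else k (with_second z (z0 v)).
  apply: (@analytic_comp _ _ _ _ (fun z => z true * z false) g (fun b => g b z0)) => //.
    by apply/poly_analytic/poly_funM; exact: poly_fun_var.
  case; first by apply/poly_analytic/poly_funD; [exact: poly_fun_var|exact: poly_fun_cst].
  exact: (analytic_with_second (t := fun=> z0 v)).
exists W, k; split=> //; last first.
  have nk := near_with_second (t := fun z => z v) kE var_an.
  apply: filterS (filterI nk (near_polydisc z0 r0)) => z [kz zr].
  apply: limit_unique ((cvg_eventually _ _).1 kz) _; apply/cvg_eventually.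
  rewrite (_ : (fun N => _) = fun N => cube_sum N (fun a => c a *
    monomial (fun i => z i - z0 i) a)); first exact: fE.
  apply/funext => N; apply: eq_bigr => a _; congr (_ * _).
  rewrite -[in RHS](set_var_id z) monomial_set_var /series_term /q /slope/=.
  congr (_ * _); rewrite (eq_bigr (fun=> (z v - z0 v) ^+ a v)) => [|j _].
    by rewrite sumr_const card_ord -(mulr_natl (_ ^+ _)) mulrA mulVf ?mul1r// gt_eqF.
  by rewrite -exprD subnK// -ltnS.
have option_var o : analytic_at (fun w : option I -> C => w o) (with_second z0 (z0 v)).
  exact/poly_analytic/poly_fun_var.
(* The two values of [W] to be compared involve [k] with its second slot at the centre: once at [z],
   and once at [z] with the variable [v] replaced by its second value. *)
pose h1 o (w : option I -> C) := with_second (w \o Some) (z0 v) o.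
pose h2 o (w : option I -> C) := with_second (set_var (w \o Some) (w None)) (z0 v) o.
have h1a o : analytic_at (h1 o) (with_second z0 (z0 v)).
  by case: o => [i|]; [exact: option_var|exact/poly_analytic/poly_fun_cst].
have h2a o : analytic_at (h2 o) (with_second z0 (z0 v)).
  case: o => [i|]; last exact/poly_analytic/poly_fun_cst.
  by rewrite /h2/= /set_var; case: (i == v); apply: option_var.
have h1E o : h1 o (with_second z0 (z0 v)) = with_second z0 (z0 v) o by case: o.
have h2E o : h2 o (with_second z0 (z0 v)) = with_second z0 (z0 v) o.
  by case: o => [i|//]; rewrite /h2/= /set_var/=; case: eqP => [->|].
apply: filterS (filterI kE (filterI (near_comp h1a h1E kE) (near_comp h2a h2E kE))).
move=> w [kw [k1 k2]] z zw; have zE : z = w \o Some by apply/funext.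
pose S w' N := cube_sum N (fun a => c a * series_term q a w').
have lim12 : (fun N => (w None - z0 v) * S (h2^~ w) N - (w (Some v) - z0 v) * S (h1^~ w) N)
    @ \oo --> W (set_var z (w None)) - W z.
  rewrite /W /set_var eqxx zE.
  exact: cvgB (cvgM (cvg_cst _) k2) (cvgM (cvg_cst _) k1).
have limk : (fun N => (w None - z v) * S w N) @ \oo --> (w None - z v) * k w.
  exact: cvgM (cvg_cst _) kw.
suff E : (fun N => (w None - z0 v) * S (h2^~ w) N - (w (Some v) - z0 v) * S (h1^~ w) N)
    = (fun N => (w None - z v) * S w N).
  rewrite E in lim12.
  exact: limit_unique ((cvg_eventually _ _).1 lim12) ((cvg_eventually _ _).1 limk).
apply/funext => N; rewrite /S /cube_sum !mulr_sumr -sumrB.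
apply: eq_bigr => a _; rewrite !(mulrCA _ (c _)) -mulrBr; congr (_ * _).
rewrite /series_term /h1 /h2 /= /set_var eqxx.
have -> : \prod_(i | i != v) ((if i == v then w None else w (Some i)) - z0 i) ^+ a i =
    \prod_(i | i != v) (w (Some i) - z0 i) ^+ a i.
  by apply: eq_bigr => i /negPf->.
rewrite !mulrA -mulrBl; congr (_ * _); rewrite /q subrr.
have slope0 t : slope (a v).+1 t 0 = t ^+ a v.
  rewrite /slope big_ord_recr/= subnn mul1r big1 ?add0r// => j _.
  by rewrite expr0n subn_eq0 leqNgt ltn_ord mul0r.
rewrite !slope0 zE /= -!mulrA ![_ * (_^-1 * _)]mulrCA -mulrBr; congr (_ * _).
rewrite -!exprS subrXX /slope/=; congr (_ * _).
by rewrite opprB addrA subrK.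
Qed.

End DividedDifferences.

(** * Functions of a list of variables *)

Section SequenceFunctions.
Context {C : numClosedFieldType} {C_complete : complete_field C}.
Implicit Types (f g : seq C -> C) (s : seq C) (P Q : seq C -> Prop).

(* Functions of several variables take the list of their arguments, so that they
   can be composed without index types; only lists of the length of [s0] matter. *)
Definition seq_analytic f s0 : Prop :=
  analytic_at (fun z : 'I_(size s0) -> C => f (codom z)) (fun i => s0`_i).

Definition seq_nbhs s0 : set_system (seq C) := fun P =>
  exists2 d, 0 < d & forall s, size s = size s0 ->
    (forall i, (i < size s0)%N -> `|s`_i - s0`_i| < d) -> P s.

(** The order of [C] is partial, but positive elements are real and therefore comparable. *)
Lemma lt_min2 (a b : C) : 0 < a -> 0 < b -> exists c, [/\ 0 < c, c <= a & c <= b].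
Proof.
move=> a0 b0; have ab : a >=< b by rewrite real_comparable ?gtr0_real.
exists (Order.min a b); rewrite /Order.min; case: ifP => // [/ltW ->//|nab].
by split=> //; rewrite comparable_leNgt ?nab// comparable_sym.
Qed.

Global Instance seq_nbhs_filter s0 : Filter (seq_nbhs s0).
Proof.
split; first by exists 1.
- move=> P Q [d d0 dP] [d' d'0 dQ]; have [c [c0 cd cd']] := lt_min2 d0 d'0.
  exists c => // s ss sc; split; [apply: dP|apply: dQ] => // i si.
    exact: lt_le_trans (sc i si) cd.
  exact: lt_le_trans (sc i si) cd'.
- by move=> P Q PQ [d d0 dP]; exists d => // s ss sd; apply/PQ/dP.
Qed.

Lemma nth_codom_ord n (z : 'I_n -> C) (i : 'I_n) : (codom z)`_i = z i.
Proof. by rewrite (nth_map i) ?size_enum_ord// nth_ord_enum. Qed.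

Lemma codom_nth n s : size s = n -> codom (fun i : 'I_n => s`_i) = s.
Proof.
move=> sn; apply: (@eq_from_nth _ 0) => [|i]; rewrite size_codom card_ord//.
by move=> i_n; rewrite -[X in _`_X]/(nat_of_ord (Ordinal i_n)) nth_codom_ord.
Qed.

Lemma seq_nbhsP s0 P : seq_nbhs s0 P <->
  \forall z \near (fun i : 'I_(size s0) => s0`_i), P (codom z).
Proof.
split=> [[d d0 dP]|/near_ballP[d d0 dP]].
  apply/near_ballP; exists d => // z zd; apply: dP => [|i i_n].
    by rewrite size_codom card_ord.
  by rewrite -[X in _`_X]/(nat_of_ord (Ordinal i_n)) nth_codom_ord; apply: zd.
exists d => // s ss sd; rewrite -(codom_nth ss); apply: dP => i.
exact: sd.
Qed.

Lemma seq_nbhs_size s0 : \forall s \near seq_nbhs s0, size s = size s0.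
Proof. by exists 1. Qed.

Lemma seq_nbhs_singleton s0 P : seq_nbhs s0 P -> P s0.
Proof. by move=> [d d0 dP]; apply: dP => // i _; rewrite subrr normr0. Qed.

Fixpoint all_prop (T : Type) (Q : T -> Prop) (l : seq T) : Prop :=
  if l is x :: l' then Q x /\ all_prop Q l' else True.

Lemma all_prop_nth (T : Type) (x : T) (Q : T -> Prop) (l : seq T) i :
  all_prop Q l -> (i < size l)%N -> Q (nth x l i).
Proof. by elim: l i => [|y l IH] [|i] //= [Qy Ql] //; apply: IH. Qed.

Lemma seq_analytic_comp_fin (J : finType) f (gs : seq ((J -> C) -> C)) (w0 : J -> C) :
  seq_analytic f [seq u w0 | u <- gs] -> all_prop (fun u => analytic_at u w0) gs ->
  analytic_at (fun w => f [seq u w | u <- gs]) w0.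
Proof.
move=> fa ga; pose n := size [seq u w0 | u <- gs].
have sn i : (i < n)%N -> (i < size gs)%N by rewrite /n size_map.
pose h (i : 'I_n) := nth (fun=> 0) gs i.
have ha i : analytic_at (h i) w0 by apply: (all_prop_nth _ ga); apply/sn/ltn_ord.
have hE i : h i w0 = [seq u w0 | u <- gs]`_i by rewrite (nth_map (fun=> 0)) ?sn.
rewrite (_ : (fun w => _) = fun w => f (codom (h^~ w))).
  exact: (analytic_comp fa ha hE).
apply/funext => w; congr f.
have sw : size [seq u w | u <- gs] = n by rewrite /n !size_map.
rewrite -(codom_nth sw); apply: eq_codom => i.
by rewrite (nth_map (fun=> 0)) ?sn.
Qed.

Lemma seq_near_comp_fin (J : finType) (gs : seq ((J -> C) -> C)) (w0 : J -> C) P :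
  seq_nbhs [seq u w0 | u <- gs] P -> all_prop (fun u => analytic_at u w0) gs ->
  \forall w \near w0, P [seq u w | u <- gs].
Proof.
move=> /seq_nbhsP nP ga; pose n := size [seq u w0 | u <- gs].
have sn i : (i < n)%N -> (i < size gs)%N by rewrite /n size_map.
pose h (i : 'I_n) := nth (fun=> 0) gs i.
have ha i : analytic_at (h i) w0 by apply: (all_prop_nth _ ga); apply/sn/ltn_ord.
have hE i : h i w0 = [seq u w0 | u <- gs]`_i by rewrite (nth_map (fun=> 0)) ?sn.
apply: filterS (near_comp ha hE nP) => w; congr P.
have sw : size [seq u w | u <- gs] = n by rewrite /n !size_map.
rewrite -(codom_nth sw); apply: eq_codom => i.
by rewrite (nth_map (fun=> 0)) ?sn.
Qed.

Lemma seq_near_codom (gs : seq (seq C -> C)) s0 :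
  all_prop (seq_analytic^~ s0) gs ->
  all_prop (fun u => analytic_at u (fun i : 'I_(size s0) => s0`_i))
    [seq (fun z : 'I_(size s0) -> C => g (codom z)) | g <- gs].
Proof. by elim: gs => //= g gs IH [ga /IH]. Qed.

Lemma seq_analytic_comp f (gs : seq (seq C -> C)) s0 :
  seq_analytic f [seq g s0 | g <- gs] -> all_prop (seq_analytic^~ s0) gs ->
  seq_analytic (fun s => f [seq g s | g <- gs]) s0.
Proof.
move=> fa /seq_near_codom ga.
have := @seq_analytic_comp_fin _ f _ _ _ ga; rewrite -map_comp.
rewrite (eq_map (g := fun u => u s0)) => [/(_ fa)|u /=]; last by rewrite codom_nth.
rewrite /seq_analytic (_ : (fun z : 'I_(size s0) -> C => f [seq u (codom z) | u <- gs]) =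
  fun z => f [seq u z | u <- [seq (fun z => g (codom z)) | g <- gs]])//.
by apply/funext => z; rewrite -map_comp.
Qed.

Lemma seq_near_comp (gs : seq (seq C -> C)) s0 P :
  seq_nbhs [seq g s0 | g <- gs] P -> all_prop (seq_analytic^~ s0) gs ->
  \forall s \near seq_nbhs s0, P [seq g s | g <- gs].
Proof.
move=> nP /seq_near_codom ga; apply/seq_nbhsP.
have := @seq_near_comp_fin _ _ _ P _ ga; rewrite -map_comp.
rewrite (eq_map (g := fun u => u s0)) => [/(_ nP)|u /=]; last by rewrite codom_nth.
by apply: filterS => z; rewrite -map_comp.
Qed.

Lemma fin_analytic_seq (I : finType) (h : (I -> C) -> C) (u : I -> seq C -> C) z0 s0 :
  analytic_at h z0 -> (forall i, seq_analytic (u i) s0) -> (forall i, u i s0 = z0 i) ->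
  seq_analytic (fun s => h (fun i => u i s)) s0.
Proof.
move=> ha ga gE.
by apply: (analytic_comp (g := fun i z => u i (codom z)) ha ga) => i; rewrite codom_nth.
Qed.

Lemma fin_near_seq (I : finType) (Q : (I -> C) -> Prop) (u : I -> seq C -> C) z0 s0 :
  (\forall z \near z0, Q z) -> (forall i, seq_analytic (u i) s0) ->
  (forall i, u i s0 = z0 i) -> \forall s \near seq_nbhs s0, Q (fun i => u i s).
Proof.
move=> nQ ga gE; apply/seq_nbhsP.
by apply: (near_comp (g := fun i z => u i (codom z)) ga _ nQ) => i; rewrite codom_nth.
Qed.

Lemma seq_analytic_cst k s0 : seq_analytic (fun=> k) s0.
Proof. exact/poly_analytic/poly_fun_cst. Qed.

Lemma seq_analytic_nth k s0 : seq_analytic (fun s => s`_k) s0.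
Proof.
rewrite /seq_analytic; have [k_n|n_k] := ltnP k (size s0).
  rewrite -[k]/(nat_of_ord (Ordinal k_n)); under eq_fun do rewrite nth_codom_ord.
  exact/poly_analytic/poly_fun_var.
under eq_fun do rewrite nth_default ?size_codom ?card_ord//.
exact/poly_analytic/poly_fun_cst.
Qed.

Lemma seq_analytic_nth_default x k s0 : seq_analytic (fun s => nth x s k) s0.
Proof.
rewrite /seq_analytic; have [k_n|n_k] := ltnP k (size s0).
  have -> : (fun z : 'I_(size s0) -> C => nth x (codom z) k) = fun z => (codom z)`_k.
    by apply/funext => z; apply: set_nth_default; rewrite size_codom card_ord.
  exact: seq_analytic_nth.
under eq_fun do rewrite nth_default ?size_codom ?card_ord//.
exact/poly_analytic/poly_fun_cst.
Qed.

Lemma seq_analyticD f g s0 :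
  seq_analytic f s0 -> seq_analytic g s0 -> seq_analytic (fun s => f s + g s) s0.
Proof.
move=> fa ga; apply: (@seq_analytic_comp (fun s => s`_0 + s`_1) [:: f; g]) => //=.
apply/poly_analytic; under eq_fun do
  rewrite (nth_codom_ord _ (@Ordinal 2 0 isT)) (nth_codom_ord _ (@Ordinal 2 1 isT)).
by apply: poly_funD; exact: poly_fun_var.
Qed.

Lemma seq_analyticM f g s0 :
  seq_analytic f s0 -> seq_analytic g s0 -> seq_analytic (fun s => f s * g s) s0.
Proof.
move=> fa ga; apply: (@seq_analytic_comp (fun s => s`_0 * s`_1) [:: f; g]) => //=.
apply/poly_analytic; under eq_fun do
  rewrite (nth_codom_ord _ (@Ordinal 2 0 isT)) (nth_codom_ord _ (@Ordinal 2 1 isT)).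
by apply: poly_funM; exact: poly_fun_var.
Qed.

Lemma seq_analyticN f s0 : seq_analytic f s0 -> seq_analytic (fun s => - f s) s0.
Proof.
move=> fa; under eq_fun do rewrite -mulN1r.
by apply: seq_analyticM => //; apply: seq_analytic_cst.
Qed.

Lemma seq_analyticB f g s0 :
  seq_analytic f s0 -> seq_analytic g s0 -> seq_analytic (fun s => f s - g s) s0.
Proof. by move=> fa ga; apply: seq_analyticD => //; apply: seq_analyticN. Qed.

Lemma seq_analytic_continuous f s0 x : seq_analytic f s0 -> 0 < x ->
  \forall s \near seq_nbhs s0, `|f s - f s0| < x.
Proof.
move=> fa x0; apply/seq_nbhsP; have := analytic_continuous fa x0.
by rewrite (codom_nth (erefl (size s0))); apply.
Qed.

Lemma seq_analytic_nonzero f s0 : seq_analytic f s0 -> f s0 != 0 ->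
  \forall s \near seq_nbhs s0, f s != 0.
Proof.
move=> fa f0; have f0' : 0 < `|f s0| by rewrite normr_gt0.
apply: filterS (seq_analytic_continuous fa f0') => s; apply: contraTneq => ->.
by rewrite sub0r normrN ltxx.
Qed.

(** The head of the list is the distinguished variable, and a list with two heads carries two values
    of it. Where these coincide, [k] plays the part of the partial derivative of [f]. *)
Definition head_difference f k s0 : Prop :=
  \forall s \near seq_nbhs s0, if s is t' :: t :: q then
    f (t' :: q) - f (t :: q) = (t' - t) * k s else True.

Section HeadVariable.
Variables (t0 : C) (q0 : seq C).
Let n := (size q0).+1.
Let z0 (i : 'I_n) := (t0 :: q0)`_i.
(** Matches lists with two heads to the points of [with_second]: the second value of the variable
    stands first in the list. *)
Let split_head (o : option 'I_n) (s : seq C) : C := if o is Some i then s`_i.+1 else s`_0.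

Let split_headE o : split_head o [:: t0, t0 & q0] = with_second z0 (z0 ord0) o.
Proof. by case: o. Qed.

Let split_head_analytic o s : seq_analytic (split_head o) s.
Proof. by case: o => [i|]; apply: seq_analytic_nth. Qed.

Let head_difference_of f k :
  (\forall w \near with_second z0 (z0 ord0), forall z, (forall i, z i = w (Some i)) ->
      f (codom (set_var ord0 z (w None))) - f (codom z) = (w None - z ord0) * k w) ->
  head_difference f (fun s => k (split_head^~ s)) [:: t0, t0 & q0].
Proof.
move=> kE; have nk := fin_near_seq kE (split_head_analytic^~ _) split_headE.
apply: filterS (filterI nk (seq_nbhs_size _)) => -[|t' [|t q]] [] //= kq [] sq.
have := kq (fun i => (t :: q)`_i) (fun=> erefl).
have -> : codom (set_var ord0 (fun i : 'I_n => (t :: q)`_i) t') = t' :: q.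
  rewrite -[RHS](@codom_nth n) /= ?sq//; apply: eq_codom => i; rewrite /set_var.
  by rewrite -val_eqE; case: i => [[|m] mn].
by rewrite codom_nth//= sq.
Qed.

Lemma seq_divided_difference f : seq_analytic f (t0 :: q0) ->
  exists2 k, seq_analytic k [:: t0, t0 & q0] & head_difference f k [:: t0, t0 & q0].
Proof.
move=> fa; have [k ka kE] := divided_difference (ord0 : 'I_n) fa.
exists (fun s => k (split_head^~ s)); last exact: head_difference_of.
exact: fin_analytic_seq ka (split_head_analytic^~ _) split_headE.
Qed.

Lemma seq_primitive p : seq_analytic p (t0 :: q0) ->
  exists W k, [/\ seq_analytic W (t0 :: q0), seq_analytic k [:: t0, t0 & q0],
    head_difference W k [:: t0, t0 & q0] &
    \forall s \near seq_nbhs (t0 :: q0), if s is t :: q then k [:: t, t & q] = p s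
      else True].
Proof.
move=> pa; have [W [k [Wa ka kE kp]]] := primitive (ord0 : 'I_n) pa.
exists (fun s => W (fun i => s`_i)), (fun s => k (split_head^~ s)); split.
- by apply: (fin_analytic_seq Wa) => // i; apply: seq_analytic_nth.
- exact: fin_analytic_seq ka (split_head_analytic^~ _) split_headE.
- apply: head_difference_of; apply: filterS kE => w kw z zw.
  have E (y : 'I_n -> C) : (fun i : 'I_n => (codom y)`_i) = y.
    by apply/funext => i; apply: nth_codom_ord.
  by rewrite !E kw.
- have va (i : 'I_n) := seq_analytic_nth i (t0 :: q0).
  have np := fin_near_seq kp va (fun=> erefl).
  apply: filterS (filterI np (seq_nbhs_size _)) => -[|t q] [] // kq [] sq.
  rewrite codom_nth in kq; last by rewrite /= sq.
  by rewrite -kq; congr k; apply/funext => -[].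
Qed.

End HeadVariable.

Lemma seq_analytic_lipschitz f t0 q0 : seq_analytic f (t0 :: q0) ->
  exists2 K, 0 <= K & \forall s \near seq_nbhs [:: t0, t0 & q0],
    if s is t' :: t :: q then `|f (t' :: q) - f (t :: q)| <= K * `|t' - t| else True.
Proof.
move=> /seq_divided_difference[k ka kE].
exists (`|k [:: t0, t0 & q0]| + 1); first exact: addr_ge0.
apply: filterS (filterI kE (seq_analytic_continuous ka ltr01)) => -[|t' [|t q]] //= [-> ks].
rewrite normrM mulrC ler_wpM2r//.
rewrite -(subrK (k [:: t0, t0 & q0]) (k [:: t', t & q])) addrC.
by apply: le_trans (ler_normD _ _) _; rewrite lerD2l ltW.
Qed.

End SequenceFunctions.

(** * Local constancy and local injectivity in the head variable *)

Section HeadAnalysis.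
Context {C : numClosedFieldType} {C_complete : complete_field C}.
Implicit Types (f g k : seq C -> C) (s q : seq C) (P Q : seq C -> Prop).

(** Recursion makes this reduce, on explicit lists, to a conjunction of inequalities. *)
Fixpoint close (d : C) s s0 : Prop :=
  match s, s0 with
  | [::], [::] => True
  | x :: s', x0 :: s0' => `|x - x0| < d /\ close d s' s0'
  | _, _ => False
  end.

Lemma closeP d s s0 : close d s s0 <->
  size s = size s0 /\ forall i, (i < size s0)%N -> `|s`_i - s0`_i| < d.
Proof.
elim: s s0 => [|x s IH] [|x0 s0] //=; try by split=> // -[].
split=> [[xd /IH[-> sd]]|[[ss] sd]]; first by split=> // -[|i] // /sd.
split; first exact: (sd 0%N).
by apply/IH; split=> // i; apply: (sd i.+1).
Qed.

Lemma close_refl d s : 0 < d -> close d s s.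
Proof. by move=> d0; elim: s => //= x s IH; rewrite subrr normr0. Qed.

Lemma close_le d d' s s0 : d <= d' -> close d s s0 -> close d' s s0.
Proof.
move=> dd' /closeP[ss sd]; apply/closeP; split=> // i si; exact: lt_le_trans (sd i si) dd'.
Qed.

Lemma seq_nbhs_close s0 P : seq_nbhs s0 P <->
  exists2 d, 0 < d & forall s, close d s s0 -> P s.
Proof.
split=> [] [d d0 dP]; exists d => // s; first by move=> /closeP[]; apply: dP.
by move=> ss sd; apply/dP/closeP.
Qed.

Lemma exists_between0 (x y : C) : 0 < x -> 0 < y -> exists t, [/\ 0 < t, t < x & t < y].
Proof.
move=> x0 y0; have [c [c0 cx cy]] := lt_min2 x0 y0; have c2 : c / 2 < c.
  by rewrite ltr_pdivrMr// ltr_pMr// ltr1n.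
by exists (c / 2); split; [rewrite divr_gt0|apply: lt_le_trans cx|apply: lt_le_trans cy].
Qed.

(* Subdividing the segment into [n] pieces bounds the increment of [F] by [K / n]. *)
Lemma quadratic_increment_const (F : C -> C) (K d t0 : C) : 0 <= K ->
  (forall a b, `|a - t0| < d -> `|b - t0| < d -> `|F a - F b| <= K * `|a - b| ^+ 2) ->
  forall t, `|t - t0| < d -> F t = F t0.
Proof.
move=> K0 FK t td; apply/eqP; rewrite -subr_eq0 -normr_le0; apply/negPn/negP => n0.
have D0 : 0 < `|F t - F t0| by rewrite normr_gt0 -normr_le0.
set A := K * `|t - t0| ^+ 2; have A0 : 0 <= A by rewrite mulr_ge0// exprn_ge0.
have A1 : 0 < A + 1 by rewrite ltr_wpDl.
have [n nD] := field_archimedean (divr_gt0 D0 A1).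
pose p j : C := t0 + j%:R / n.+1%:R * (t - t0).
have n0' : n.+1%:R != 0 :> C by rewrite pnatr_eq0.
have pd j : (j <= n.+1)%N -> `|p j - t0| < d.
  move=> jn; rewrite /p addrC addKr normrM; apply: le_lt_trans td.
  rewrite ler_piMl// ger0_norm ?divr_ge0// ler_pdivrMr ?ltr0n// mul1r ler_nat//.
have pB j : p j.+1 - p j = (t - t0) / n.+1%:R.
  by rewrite /p -natr1; field.
have : `|F t - F t0| <= A / n.+1%:R.
  have -> : F t - F t0 = \sum_(0 <= j < n.+1) (F (p j.+1) - F (p j)).
    by rewrite telescope_sumr// /p !mul0r addr0 divff// mul1r [t0 + _]addrC subrK.
  rewrite big_mkord; apply: le_trans (ler_norm_sum _ _ _) _.
  apply: (@le_trans _ _ (\sum_(j < n.+1) A / n.+1%:R ^+ 2)).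
    apply: ler_sum => j _; apply: le_trans (FK _ _ (pd _ (ltn_ord j)) (pd _ (ltnW (ltn_ord j)))) _.
    by rewrite pB normrM normfV normr_nat exprMn exprVn mulrA.
  rewrite sumr_const card_ord -(mulr_natr (_ / _)) expr2 invfM.
  by rewrite -!mulrA mulVf// mulr1.
move=> FA; suff : A / n.+1%:R < `|F t - F t0| by move=> /(le_lt_trans FA); rewrite ltxx.
apply: (@le_lt_trans _ _ ((A + 1) / n.+1%:R)); first by rewrite ler_wpM2r ?invr_ge0// lerDl.
by rewrite mulrC -ltr_pdivlMr.
Qed.

(** [k] is Lipschitz in its first entry and vanishes on the diagonal, so that the increment of [f]
    is bounded by the square of the increment of its head variable. *)
Lemma seq_locally_constant f k t0 q0 :
  seq_analytic k [:: t0, t0 & q0] -> head_difference f k [:: t0, t0 & q0] ->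
  (\forall s \near seq_nbhs (t0 :: q0), if s is t :: q then k [:: t, t & q] = 0
     else True) ->
  \forall s \near seq_nbhs (t0 :: q0), if s is t :: q then f s = f (t0 :: q) else True.
Proof.
move=> /seq_analytic_lipschitz[K K0 /seq_nbhs_close[d1 d10 kL]].
move=> /seq_nbhs_close[d2 d20 fk] /seq_nbhs_close[d3 d30 kd].
have [d12 [d120 d121 d122]] := lt_min2 d10 d20.
have [d [d0 dd12 dd3]] := lt_min2 d120 d30.
have dd1 := le_trans dd12 d121; have dd2 := le_trans dd12 d122.
apply/seq_nbhs_close; exists d => // -[|t q] //= [td qd].
apply: (quadratic_increment_const (F := fun t => f (t :: q)) (d := d) K0) => // a b ad bd.
have /= -> := fk [:: a, b & q]; last first.
  by split; [apply: lt_le_trans dd2|split; [apply: lt_le_trans dd2|apply: close_le qd]].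
rewrite normrM mulrC expr2 mulrA ler_wpM2r//.
have k0 : k [:: b, b & q] = 0.
  by apply: (kd (b :: q)); split; [apply: lt_le_trans dd3|apply: close_le qd].
have /= := kL [:: a, b, b & q]; rewrite k0 subr0; apply.
by do 3! [split; first by apply: lt_le_trans dd1]; apply: close_le qd.
Qed.

(** Division by [t' - t] is possible only off the diagonal; the Lipschitz bound carries the
    vanishing of [k] over to the diagonal. *)
Lemma seq_head_cancel k t0 q0 : seq_analytic k [:: t0, t0 & q0] ->
  (\forall s \near seq_nbhs [:: t0, t0 & q0],
     if s is t' :: t :: q then (t' - t) * k s = 0 else True) ->
  \forall s \near seq_nbhs (t0 :: q0), if s is t :: q then k [:: t, t & q] = 0 else True.
Proof.
move=> /seq_analytic_lipschitz[K K0 /seq_nbhs_close[d1 d10 kL]].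
move=> /seq_nbhs_close[d2 d20 kd].
have [d [d0 dd1 dd2]] := lt_min2 d10 d20; have d20' : 0 < d / 2 by rewrite divr_gt0.
have d2d : d / 2 <= d by rewrite ler_pdivrMr// ler_peMr ?ler1n// ltW.
apply/seq_nbhs_close; exists (d / 2) => // -[|t q] //= [td qd].
apply/eqP; rewrite -normr_le0; apply/negPn/negP => n0.
have D0 : 0 < `|k [:: t, t & q]| by rewrite normr_gt0 -normr_le0.
have K1 : 0 < K + 1 by rewrite ltr_wpDl.
(* With this [x] the Lipschitz bound [K * x] falls below the supposedly nonzero value of [k]. *)
have [x [x0 xd xD]] := exists_between0 d20' (divr_gt0 D0 K1).
pose a := t + x; have ax : a - t = x by rewrite /a addrC addKr.
have ad : `|a - t0| < d.
  rewrite /a addrAC [ltRHS](splitr d); apply: le_lt_trans (ler_normD _ _) _.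
  by rewrite ltrD// gtr0_norm.
have ka : k [:: a, t & q] = 0.
  have /= := kd [:: a, t & q]; rewrite ax => kax.
  apply: (mulfI (lt0r_neq0 x0)); rewrite mulr0; apply: kax.
  split; first exact: lt_le_trans dd2.
  by split; [apply: lt_le_trans (le_trans d2d dd2)|apply: close_le qd; apply: le_trans dd2].
have /= := kL [:: a, t, t & q]; rewrite ka sub0r normrN ax (gtr0_norm x0).
suff cl : `|a - t0| < d1 /\ `|t - t0| < d1 /\ `|t - t0| < d1 /\ close d1 q q0.
  move=> /(_ cl) kx.
  suff : K * x < `|k [:: t, t & q]| by move=> /(le_lt_trans kx); rewrite ltxx.
  apply: (@le_lt_trans _ _ ((K + 1) * x)).
    by rewrite ler_wpM2r ?(ltW x0)// lerDl.
  by rewrite mulrC -ltr_pdivlMr.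
have td1 : `|t - t0| < d1 by apply: lt_le_trans (le_trans d2d dd1).
split; first exact: lt_le_trans dd1.
by do 2! [split=> //]; apply: close_le qd; apply: le_trans dd1.
Qed.

(* The left inverse [g] is Lipschitz, which forbids a vanishing derivative. *)
Lemma head_difference_nonzero f g k t0 q0 :
  seq_analytic f (t0 :: q0) -> seq_analytic g (f (t0 :: q0) :: q0) ->
  (\forall s \near seq_nbhs (t0 :: q0), if s is t :: q then g (f s :: q) = t else True) ->
  seq_analytic k [:: t0, t0 & q0] -> head_difference f k [:: t0, t0 & q0] ->
  k [:: t0, t0 & q0] != 0.
Proof.
move=> fa /seq_analytic_lipschitz[K K0 /seq_nbhs_close[d1 d10 gL]].
move=> /seq_nbhs_close[d2 d20 gf] ka /seq_nbhs_close[d3 d30 fk].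
have K1 : 0 < K + 1 by rewrite ltr_wpDl.
(* If [k] vanished at the base point, this threshold would make [g] after [f] contract the step [x]
   strictly, although it is the identity. *)
have /seq_nbhs_close[d4 d40 kc] : \forall s \near seq_nbhs [:: t0, t0 & q0],
    `|k s - k [:: t0, t0 & q0]| < (K + 1)^-1.
  by apply: seq_analytic_continuous; rewrite ?invr_gt0.
have /seq_nbhs_close[d5 d50 fc] : \forall s \near seq_nbhs (t0 :: q0),
    `|f s - f (t0 :: q0)| < d1.
  exact: seq_analytic_continuous.
have [x1 [x10 x1d2 x1d3]] := exists_between0 d20 d30.
have [x2 [x20 x2x1 x2d4]] := exists_between0 x10 d40.
have [x [x0 xx2 xd5]] := exists_between0 x20 d50.
have xd4 := lt_trans xx2 x2d4; have xx1 := lt_trans xx2 x2x1.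
have xd3 := lt_trans xx1 x1d3; have xd2 := lt_trans xx1 x1d2.
apply/eqP => k0; pose t := t0 + x.
have tx : t - t0 = x by rewrite /t addrC addKr.
have closet d : x < d -> close d (t :: q0) (t0 :: q0).
  by move=> xd; rewrite /= tx gtr0_norm//; split=> //; apply/close_refl/(lt_trans x0).
have closett d : x < d -> close d [:: t, t0 & q0] [:: t0, t0 & q0].
  move=> xd; have d0 := lt_trans x0 xd; rewrite /= tx gtr0_norm//.
  by split=> //; apply: (close_refl (t0 :: q0)).
have kt := kc _ (closett _ xd4); rewrite k0 subr0 in kt.
have /= ft := fk _ (closett _ xd3); rewrite tx in ft.
have /= gft := gf _ (closet _ xd2).
have /= gft0 := gf _ (close_refl (t0 :: q0) d20).
have /= := gL [:: f (t :: q0), f (t0 :: q0) & q0].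
rewrite gft gft0 tx ft subrr normr0 normrM (gtr0_norm x0) mulrCA => gLx.
have := fc _ (closet _ xd5); rewrite ft normrM (gtr0_norm x0) => fcx.
have {}gLx := gLx (conj fcx (conj d10 (close_refl _ d10))).
suff : x * (K * `|k [:: t, t0 & q0]|) < x by move=> /(le_lt_trans gLx); rewrite ltxx.
rewrite gtr_pMr//.
apply: (@le_lt_trans _ _ ((K + 1) * `|k [:: t, t0 & q0]|)).
  by rewrite ler_wpM2r// lerDl.
by rewrite mulrC -ltr_pdivlMr// div1r.
Qed.

Lemma head_injective f k t0 q0 :
  seq_analytic k [:: t0, t0 & q0] -> head_difference f k [:: t0, t0 & q0] ->
  k [:: t0, t0 & q0] != 0 ->
  \forall s \near seq_nbhs [:: t0, t0 & q0],
    if s is t' :: t :: q then f (t' :: q) = f (t :: q) -> t' = t else True.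
Proof.
move=> ka fk /(seq_analytic_nonzero ka) k0.
apply: filterS (filterI fk k0) => -[|t' [|t q]] //= [ftk ks ftt].
move: ftk; rewrite ftt subrr => /esym/eqP; rewrite mulf_eq0 (negPf ks) orbF subr_eq0.
by move/eqP.
Qed.

End HeadAnalysis.

(** * Cocycles on a tetrahedron *)

Section Tetrahedron.
Context {C : numClosedFieldType} {C_complete : complete_field C}.
Implicit Types (f g k w : seq C -> C) (s q : seq C) (P Q R : seq C -> Prop).

Definition app f (gs : seq (seq C -> C)) s : C := f [seq u s | u <- gs].
Arguments app f gs s /.

Local Notation "$ k" := (fun s : seq C => s`_k) (at level 1, format "$ k").

Lemma app_analytic f (gs : seq (seq C -> C)) t0 s0 : seq_analytic f t0 ->
  all_prop (seq_analytic^~ s0) gs -> [seq u s0 | u <- gs] = t0 ->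
  seq_analytic (app f gs) s0.
Proof. by move=> fa ga gE; apply: seq_analytic_comp => //; rewrite gE. Qed.

Lemma seq_near_at P (gs : seq (seq C -> C)) t0 s0 : seq_nbhs t0 P ->
  all_prop (seq_analytic^~ s0) gs -> [seq u s0 | u <- gs] = t0 ->
  \forall s \near seq_nbhs s0, P [seq u s | u <- gs].
Proof. by move=> nP ga gE; apply: seq_near_comp => //; rewrite gE. Qed.

(* A triangle with fields [h1], [h2], [h3] at the vertices and [y12], [y13],
   [y23] on the edges carries the relation [R], which is solved for the edges. *)
Definition edges_solved R (h1 h2 h3 y12 y13 y23 : C) (f12 f13 f23 : seq C -> C) : Prop :=
  [/\ R [:: h1; h2; h3; y12; y13; y23],
      seq_analytic f12 [:: h1; h2; h3; y13; y23],
      seq_analytic f13 [:: h1; h2; h3; y12; y23],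
      seq_analytic f23 [:: h1; h2; h3; y12; y13] &
      \forall s \near seq_nbhs [:: h1; h2; h3; y12; y13; y23],
        if s is [:: g1; g2; g3; x12; x13; x23] then
          [/\ R s <-> x12 = f12 [:: g1; g2; g3; x13; x23],
              R s <-> x13 = f13 [:: g1; g2; g3; x12; x23] &
              R s <-> x23 = f23 [:: g1; g2; g3; x12; x13]]
        else True].

Lemma edges_solved_base R h1 h2 h3 y12 y13 y23 f12 f13 f23 :
  edges_solved R h1 h2 h3 y12 y13 y23 f12 f13 f23 ->
  [/\ f12 [:: h1; h2; h3; y13; y23] = y12, f13 [:: h1; h2; h3; y12; y23] = y13 &
      f23 [:: h1; h2; h3; y12; y13] = y23].
Proof.
case=> R0 _ _ _ /seq_nbhs_singleton[[N1 _] [N2 _] [N3 _]].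
by split; apply/esym; [apply: N1|apply: N2|apply: N3].
Qed.

Variables (a0 b0 c0 d0 ab0 ac0 bc0 ad0 bd0 cd0 : C).
Variables (Ra Rb Rc Rd : seq C -> Prop).
Variables (fa_bc fa_bd fa_cd fb_ac fb_ad fb_cd fc_ab fc_ad fc_bd fd_ab fd_ac fd_bc
  : seq C -> C).
Hypothesis Ra_solved : edges_solved Ra b0 c0 d0 bc0 bd0 cd0 fa_bc fa_bd fa_cd.
Hypothesis Rb_solved : edges_solved Rb a0 c0 d0 ac0 ad0 cd0 fb_ac fb_ad fb_cd.
Hypothesis Rc_solved : edges_solved Rc a0 b0 d0 ab0 ad0 bd0 fc_ab fc_ad fc_bd.
Hypothesis Rd_solved : edges_solved Rd a0 b0 c0 ab0 ac0 bc0 fd_ab fd_ac fd_bc.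
Hypothesis R_consistent :
  \forall s \near seq_nbhs [:: a0; b0; c0; d0; ab0; ac0; bc0; ad0; bd0; cd0],
    if s is [:: a; b; c; d; ab; ac; bc; ad; bd; cd] then
      let ra := Ra [:: b; c; d; bc; bd; cd] in let rb := Rb [:: a; c; d; ac; ad; cd] in
      let rc := Rc [:: a; b; d; ab; ad; bd] in let rd := Rd [:: a; b; c; ab; ac; bc] in
      [/\ ra -> rb -> rc -> rd, ra -> rc -> rd -> rb & rb -> rc -> rd -> ra]
    else True.

Ltac analytic_step := match goal with
  | |- True => exact I
  | |- _ /\ _ => split
  | |- all_prop _ _ => rewrite /=
  | |- seq_analytic (fun s => s`_ _) _ => apply: seq_analytic_nth
  | |- seq_analytic (cst _) _ => apply: seq_analytic_cst
  | H : seq_analytic ?f _ |- seq_analytic (app ?f _) _ => apply: (app_analytic H)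
  | H : seq_analytic ?f _ |- seq_analytic ?f _ => exact: H
  | |- seq_analytic (fun s => _ - _) _ => apply: seq_analyticB
  | |- seq_analytic (fun s => _ + _) _ => apply: seq_analyticD
  | |- seq_analytic (fun s => _ * _) _ => apply: seq_analyticM
  | |- seq_analytic ?u _ => is_var u; unfold u
  | |- _ = _ :> seq _ =>
     repeat match goal with x := _ |- context[?y] => constr_eq x y; unfold x end;
     rewrite /=; repeat match goal with H : ?f ?l = _ |- context [?f ?l] => rewrite H end;
     reflexivity
  end.
Ltac analytic := repeat analytic_step.
(** Pulls the local statement [N0] back along the substitution [gs] at the base point [s0];
    [analytic] checks that the functions in [gs] are analytic and take the right base values. *)
Ltac near_at N N0 s0 gs :=
  have N := seq_near_at (gs := gs) (s0 := s0) N0;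
  match type of N with ?A -> ?B -> _ =>
    let H := fresh in
    have H : A by [analytic]; move/(_ H) in N; clear H;
    have H : B by [analytic]; move/(_ H) in N; clear H
  end.

Lemma top_face_cocycle : exists wab wac wbc : seq C -> C,
  [/\ seq_analytic wab [:: a0; b0; ab0], seq_analytic wac [:: a0; c0; ac0],
      seq_analytic wbc [:: b0; c0; bc0] &
      \forall s \near seq_nbhs [:: a0; b0; c0; ab0; ac0; bc0],
        if s is [:: a; b; c; ab; ac; bc] then
          Rd s <-> wab [:: a; b; ab] + wbc [:: b; c; bc] = wac [:: a; c; ac]
        else True].
Proof.
have [fa_bc0 fa_bd0 fa_cd0] := edges_solved_base Ra_solved.
have [fb_ac0 fb_ad0 fb_cd0] := edges_solved_base Rb_solved.
have [fc_ab0 fc_ad0 fc_bd0] := edges_solved_base Rc_solved.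
have [_ fa_bca fa_bda fa_cda Na] := Ra_solved.
have [_ fb_aca fb_ada fb_cda Nb] := Rb_solved.
have [_ fc_aba fc_ada fc_bda Nc] := Rc_solved.
(* The edge joining the spoke [eta_b v be] to [be] is the edge joining [ad0] to
   [v]; [G] is the spoke joined to [be] by the edge [y]. *)
pose eta_b := app fc_ad [:: cst a0; $2; cst d0;
  app fc_ab [:: cst a0; $2; cst d0; cst ad0; $0]; $1].
have eta_ba : seq_analytic eta_b [:: bd0; bd0; b0] by rewrite /eta_b; analytic.
have eta_b0 : eta_b [:: bd0; bd0; b0] = ad0 by rewrite /eta_b/= fc_ab0.
have eta_bE v be hb : eta_b [:: v; be; hb] =
  fc_ad [:: a0; hb; d0; fc_ab [:: a0; hb; d0; ad0; v]; be] by [].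
pose eta_c := app fb_ad [:: cst a0; $2; cst d0;
  app fb_ac [:: cst a0; $2; cst d0; cst ad0; $0]; $1].
have eta_ca : seq_analytic eta_c [:: cd0; cd0; c0] by rewrite /eta_c; analytic.
have eta_c0 : eta_c [:: cd0; cd0; c0] = ad0 by rewrite /eta_c/= fb_ac0.
have eta_cE v ga hc : eta_c [:: v; ga; hc] =
  fb_ad [:: a0; hc; d0; fb_ac [:: a0; hc; d0; ad0; v]; ga] by [].
pose G := app fa_cd [:: $1; $2; cst d0; $3; $0].
have Ga : seq_analytic G [:: bd0; b0; c0; bc0] by rewrite /G; analytic.
have G0 : G [:: bd0; b0; c0; bc0] = cd0 by rewrite /G/=.
have GE be hb hc y : G [:: be; hb; hc; y] = fa_cd [:: hb; hc; d0; y; be] by [].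
clearbody eta_b eta_c G.
have eta_b_diag : \forall s \near seq_nbhs [:: bd0; b0],
    if s is [:: be; hb] then eta_b [:: be; be; hb] = ad0 else True.
  near_at N Nc [:: bd0; b0] [:: cst a0; $1; cst d0;
      app fc_ab [:: cst a0; $1; cst d0; cst ad0; $0]; cst ad0; $0].
  apply: filterS N => -[|be [|hb [|? ?]]] //= [N1 N2 _].
  by rewrite eta_bE; apply/esym/N2/N1.
have eta_c_diag : \forall s \near seq_nbhs [:: cd0; c0],
    if s is [:: ga; hc] then eta_c [:: ga; ga; hc] = ad0 else True.
  near_at N Nb [:: cd0; c0] [:: cst a0; $1; cst d0;
      app fb_ac [:: cst a0; $1; cst d0; cst ad0; $0]; cst ad0; $0].
  apply: filterS N => -[|ga [|hc [|? ?]]] //= [N1 N2 _].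
  by rewrite eta_cE; apply/esym/N2/N1.
(* Consistency is used twice with the same top edges. At the spokes [ad0], [v], [Gv] the relations
   [Ra], [Rb], [Rc] give [Rd]; at the spokes [al], [be], [Gbe] the relations [Ra], [Rc], [Rd] give
   [Rb], which identifies [al] with the spoke obtained by transport through the edge ac. *)
have eta_bc : \forall s \near seq_nbhs [:: bd0; bd0; b0; c0; bc0],
    if s is [:: v; be; hb; hc; y] then
      eta_c [:: G [:: v; hb; hc; y]; G [:: be; hb; hc; y]; hc] = eta_b [:: v; be; hb]
    else True.
  set s0 := [:: _; _; _; _; _].
  pose Gv := app G [:: $0; $2; $3; $4]; pose Gbe := app G [:: $1; $2; $3; $4].
  pose yab := app fc_ab [:: cst a0; $2; cst d0; cst ad0; $0].
  pose yac := app fb_ac [:: cst a0; $3; cst d0; cst ad0; Gv].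
  pose al := app eta_b [:: $0; $1; $2].
  near_at N1 Nc s0 [:: cst a0; $2; cst d0; yab; cst ad0; $0].
  near_at N2 Nc s0 [:: cst a0; $2; cst d0; yab; al; $1].
  near_at N3 Nb s0 [:: cst a0; $3; cst d0; yac; cst ad0; Gv].
  near_at N4 Nb s0 [:: cst a0; $3; cst d0; yac; al; Gbe].
  near_at N5 Na s0 [:: $2; $3; cst d0; $4; $1; Gbe].
  near_at N6 Na s0 [:: $2; $3; cst d0; $4; $0; Gv].
  near_at N7 R_consistent s0 [:: cst a0; $2; $3; cst d0; yab; yac; $4; cst ad0; $0; Gv].
  near_at N8 R_consistent s0 [:: cst a0; $2; $3; cst d0; yab; yac; $4; al; $1; Gbe].
  apply: filterS (filterI (filterI (filterI N1 N2) (filterI N3 N4))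
    (filterI (filterI N5 N6) (filterI N7 N8))) => -[|v [|be [|hb [|hc [|y [|? ?]]]]]]; rewrite /yab /yac /al /Gv /Gbe //=.
  move=> [[[[[_ rc1] _ _] [_ [_ rc2] _]] [[[_ rb1] _ _] [_ [rb2 _] _]]]].
  move=> [[[_ _ [_ ra1]] [_ _ [_ ra2]]] [[rd _ _] [_ rb _]]].
  rewrite eta_cE; apply/esym/rb2/rb; [exact/ra1/GE|exact/rc2/eta_bE|].
  by apply: rd; [exact/ra2/GE|exact: rb1|exact: rc1].
(* By [eta_bc], the derivatives [p_b], [p_c] of [eta_b], [eta_c] on the diagonal
   satisfy [p_c(G) G' = p_b], so that [Phi] below does not depend on [be]. *)
have [kb kba kbE] := seq_divided_difference eta_ba.
have [kc kca kcE] := seq_divided_difference eta_ca.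
have [kG kGa kGE] := seq_divided_difference Ga.
have pba : seq_analytic (app kb [:: $0; $0; $0; $1]) [:: bd0; b0] by analytic.
have pca : seq_analytic (app kc [:: $0; $0; $0; $1]) [:: cd0; c0] by analytic.
have [Wb [kWb [Wba kWba WbE kWbE]]] := seq_primitive pba.
have [Wc [kWc [Wca kWca WcE kWcE]]] := seq_primitive pca.
pose Phi s := app Wc [:: G; $2] s - app Wb [:: $0; $1] s.
have Phia : seq_analytic Phi [:: bd0; b0; c0; bc0] by rewrite /Phi; analytic.
pose Gv := app G [:: $0; $2; $3; $4]; pose Gbe := app G [:: $1; $2; $3; $4].
(* [rho] is the divided difference of [Phi] in the spoke [be]. On the diagonal it agrees with
   [sigma], built from the divided differences of [eta_b] and [eta_c] instead of those of their
   primitives; [eta_bc] forces [sigma] to vanish there. *)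
pose rho s := kG s * app kWc [:: Gv; Gbe; $3] s - app kWb [:: $0; $1; $2] s.
pose sigma s := kG s * app kc [:: Gv; Gbe; Gbe; $3] s - app kb [:: $0; $1; $1; $2] s.
set s0 := [:: bd0; bd0; b0; c0; bc0].
have rhoa : seq_analytic rho s0 by rewrite /rho; analytic.
have sigmaa : seq_analytic sigma s0 by rewrite /sigma; analytic.
have sigma_diag : \forall s \near seq_nbhs [:: bd0; b0; c0; bc0],
    if s is be :: q then sigma [:: be, be & q] = 0 else True.
  apply: seq_head_cancel => //.
  near_at N1 kbE s0 [:: $0; $1; $1; $2].
  near_at N2 kcE s0 [:: Gv; Gbe; Gbe; $3].
  near_at N3 eta_b_diag s0 [:: $1; $2].
  near_at N4 eta_c_diag s0 [:: Gbe; $3].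
  apply: filterS (filterI (filterI (filterI N1 N2) (filterI N3 N4))
    (filterI eta_bc (filterI kGE (seq_nbhs_size _)))).
  move=> -[|v [|be [|hb [|hc [|y [|? ?]]]]]]; rewrite /sigma /Gv /Gbe //=; try by do 3! case=> _.
  move=> [[[E1 E2] [E3 E4]] [E5 [E6 _]]].
  by rewrite mulrBr mulrA -E6 -E2 -E1 E5 E4 E3 subrr.
have Phi_const : \forall s \near seq_nbhs [:: bd0; b0; c0; bc0],
    if s is be :: q then Phi s = Phi (bd0 :: q) else True.
  apply: (seq_locally_constant rhoa).
    near_at N1 WbE s0 [:: $0; $1; $2].
    near_at N2 WcE s0 [:: Gv; Gbe; $3].
    apply: filterS (filterI (filterI N1 N2) (filterI kGE (seq_nbhs_size _))).
    move=> -[|v [|be [|hb [|hc [|y [|? ?]]]]]]; rewrite /Phi /rho /Gv /Gbe //=; try by do 2! case=> _.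
    move=> [[E1 E2] [E3 _]]; rewrite mulrBr mulrA -E3 -E2 -E1; ring.
  near_at N1 kWbE [:: bd0; b0; c0; bc0] [:: $0; $1].
  near_at N2 kWcE [:: bd0; b0; c0; bc0] [:: G; $2].
  apply: filterS (filterI (filterI N1 N2) (filterI sigma_diag (seq_nbhs_size _))).
  move=> -[|be [|hb [|hc [|y [|? ?]]]]]; rewrite /sigma /rho /Gv /Gbe //=; try by do 2! case=> _.
  move=> [[E1 E2] [E3 _]]; by rewrite E2 E1.
(* [theta] recovers the spoke [v] from the spoke [eta_c] assigns to it, so that the diagonal
   derivative of [eta_c], which is the derivative of [Wc], is nonzero. *)
have kWc0 : kWc [:: cd0; cd0; c0] != 0.
  have /= -> := seq_nbhs_singleton kWcE.
  pose theta := app fb_cd [:: cst a0; $2; cst d0;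
    app fb_ac [:: cst a0; $2; cst d0; $0; $1]; cst ad0].
  have thetaa : seq_analytic theta [:: ad0; cd0; c0] by rewrite /theta; analytic.
  apply: (head_difference_nonzero eta_ca (g := theta)); rewrite ?eta_c0//.
  near_at N1 Nb [:: cd0; cd0; c0] [:: cst a0; $2; cst d0;
    app fb_ac [:: cst a0; $2; cst d0; cst ad0; $0]; cst ad0; $0].
  near_at N2 Nb [:: cd0; cd0; c0] [:: cst a0; $2; cst d0;
    app fb_ac [:: cst a0; $2; cst d0; cst ad0; $0]; eta_c; $1].
  apply: filterS (filterI N1 (filterI N2 (seq_nbhs_size _))).
  move=> -[|v [|ga [|hc [|? ?]]]]; rewrite /theta //=; try by do 2! case=> _.
  move=> [[[_ rb1] _ [rb1' _]] [[[rb2 _] [_ rb2'] _] _]].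
  by rewrite -rb2; [apply/esym/rb1'/rb1|apply/rb2'/eta_cE].
have Wc_inj := head_injective (C_complete := C_complete) kWca WcE kWc0.
(* The edges ab and ac are measured by the spokes bd and cd that they join to [ad0], and the edge bc
   by [Phi], evaluated at the spoke [bd0] since it does not depend on the spoke. *)
pose wab := app Wb [:: app fc_bd [:: $0; $1; cst d0; $2; cst ad0]; $1].
pose wac := app Wc [:: app fb_cd [:: $0; $1; cst d0; $2; cst ad0]; $1].
pose wbc := app Phi [:: cst bd0; $0; $1; $2].
exists wab, wac, wbc; split; [rewrite /wab|rewrite /wac|rewrite /wbc|]; try by analytic.
set t0 := [:: _; _; _; _; _; _].
pose be := app fc_bd [:: $0; $1; cst d0; $3; cst ad0].
pose ga := app fb_cd [:: $0; $2; cst d0; $4; cst ad0].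
near_at N1 Nb t0 [:: $0; $2; cst d0; $4; cst ad0; ga].
near_at N2 Nc t0 [:: $0; $1; cst d0; $3; cst ad0; be].
near_at N3 Na t0 [:: $1; $2; cst d0; $5; be; ga].
near_at N4 R_consistent t0 [:: $0; $1; $2; cst d0; $3; $4; $5; cst ad0; be; ga].
near_at N5 Phi_const t0 [:: be; $1; $2; $5].
near_at N6 Wc_inj t0 [:: ga; app G [:: be; $1; $2; $5]; $2].
apply: filterS (filterI (filterI (filterI N1 N2) (filterI N3 N4)) (filterI N5 N6)).
move=> -[|a [|b [|c [|ab [|ac [|bc [|? ?]]]]]]]; rewrite /be /ga /wab /wac /wbc //=.
move=> [[[[_ _ [_ rb]] [_ _ [_ rc]]] [[_ _ [ra1 ra2]] [rd _ ra]]] [E5 E6]].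
(* With [Phi] evaluated at the spoke [be], the cocycle condition says that [Wc] takes equal values
   at [G] of [be] and at [ga]. By injectivity this is the relation [Ra] for the spokes [be] and
   [ga]. *)
rewrite -E5 /Phi/= addrC subrK; split=> [rd'|/esym /E6].
  by congr (Wc [:: _; _]); rewrite GE; apply/esym/ra1/ra => //; [exact: rb|exact: rc].
rewrite GE => /ra2 ra'; apply: rd => //; [exact: rb|exact: rc].
Qed.

Theorem tetrahedron_cocycle : exists wab wac wbc wad wbd wcd : seq C -> C,
  [/\ [/\ seq_analytic wab [:: a0; b0; ab0], seq_analytic wac [:: a0; c0; ac0] &
          seq_analytic wbc [:: b0; c0; bc0]],
      [/\ seq_analytic wad [:: a0; d0; ad0], seq_analytic wbd [:: b0; d0; bd0] &
          seq_analytic wcd [:: c0; d0; cd0]] &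
      \forall s \near seq_nbhs [:: a0; b0; c0; d0; ab0; ac0; bc0; ad0; bd0; cd0],
        if s is [:: a; b; c; d; ab; ac; bc; ad; bd; cd] then
          [/\ Ra [:: b; c; d; bc; bd; cd] <->
                wbc [:: b; c; bc] + wcd [:: c; d; cd] = wbd [:: b; d; bd],
              Rb [:: a; c; d; ac; ad; cd] <->
                wac [:: a; c; ac] + wcd [:: c; d; cd] = wad [:: a; d; ad],
              Rc [:: a; b; d; ab; ad; bd] <->
                wab [:: a; b; ab] + wbd [:: b; d; bd] = wad [:: a; d; ad] &
              Rd [:: a; b; c; ab; ac; bc] <->
                wab [:: a; b; ab] + wbc [:: b; c; bc] = wac [:: a; c; ac]]
        else True].
Proof.
have [wab [wac [wbc [waba waca wbca Nw]]]] := top_face_cocycle.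
have [fa_bc0 fa_bd0 fa_cd0] := edges_solved_base Ra_solved.
have [fb_ac0 fb_ad0 fb_cd0] := edges_solved_base Rb_solved.
have [fc_ab0 fc_ad0 fc_bd0] := edges_solved_base Rc_solved.
have [fd_ab0 fd_ac0 fd_bc0] := edges_solved_base Rd_solved.
have [_ fa_bca fa_bda fa_cda Na] := Ra_solved.
have [_ fb_aca fb_ada fb_cda Nb] := Rb_solved.
have [_ fc_aba fc_ada fc_bda Nc] := Rc_solved.
have [_ fd_aba fd_aca fd_bca Nd] := Rd_solved.
(* An edge bc completing [y] to a solution of [Rd] also completes [y'], because the legs have equal
   values; and [Rd] determines the edge ab from the other fields. The other two legs are treated in
   the same way. *)
have wab_inj : \forall s \near seq_nbhs [:: ab0; ab0; a0; b0],
    if s is [:: y'; y; a; b] then wab [:: a; b; y'] = wab [:: a; b; y] -> y' = y else True.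
  set s0 := [:: _; _; _; _]; pose bc := app fd_bc [:: $2; $3; cst c0; $1; cst ac0].
  near_at N1 Nd s0 [:: $2; $3; cst c0; $0; cst ac0; bc].
  near_at N2 Nd s0 [:: $2; $3; cst c0; $1; cst ac0; bc].
  near_at N3 Nw s0 [:: $2; $3; cst c0; $0; cst ac0; bc].
  near_at N4 Nw s0 [:: $2; $3; cst c0; $1; cst ac0; bc].
  apply: filterS (filterI (filterI N1 N2) (filterI N3 N4)).
  move=> -[|y' [|y [|a [|b [|? ?]]]]]; rewrite /bc //=.
  move=> [[[[rd1 _] _ _] [[rd2 _] _ [_ rd3]]] [[_ w1] [w2 _]]] ww.
  rewrite rd1; first by apply/esym/rd2/rd3.
  by apply: w1; rewrite ww; apply/w2/rd3.
have wac_inj : \forall s \near seq_nbhs [:: ac0; ac0; a0; c0],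
    if s is [:: y'; y; a; c] then wac [:: a; c; y'] = wac [:: a; c; y] -> y' = y else True.
  set s0 := [:: _; _; _; _]; pose bc := app fd_bc [:: $2; cst b0; $3; cst ab0; $1].
  near_at N1 Nd s0 [:: $2; cst b0; $3; cst ab0; $0; bc].
  near_at N2 Nd s0 [:: $2; cst b0; $3; cst ab0; $1; bc].
  near_at N3 Nw s0 [:: $2; cst b0; $3; cst ab0; $0; bc].
  near_at N4 Nw s0 [:: $2; cst b0; $3; cst ab0; $1; bc].
  apply: filterS (filterI (filterI N1 N2) (filterI N3 N4)).
  move=> -[|y' [|y [|a [|c [|? ?]]]]]; rewrite /bc //=.
  move=> [[[_ [rd1 _] _] [_ [rd2 _] [_ rd3]]] [[_ w1] [w2 _]]] ww.
  rewrite rd1; first by apply/esym/rd2/rd3.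
  by apply: w1; rewrite ww; apply/w2/rd3.
have wbc_inj : \forall s \near seq_nbhs [:: bc0; bc0; b0; c0],
    if s is [:: y'; y; b; c] then wbc [:: b; c; y'] = wbc [:: b; c; y] -> y' = y else True.
  set s0 := [:: _; _; _; _]; pose ab := app fd_ab [:: cst a0; $2; $3; cst ac0; $1].
  near_at N1 Nd s0 [:: cst a0; $2; $3; ab; cst ac0; $0].
  near_at N2 Nd s0 [:: cst a0; $2; $3; ab; cst ac0; $1].
  near_at N3 Nw s0 [:: cst a0; $2; $3; ab; cst ac0; $0].
  near_at N4 Nw s0 [:: cst a0; $2; $3; ab; cst ac0; $1].
  apply: filterS (filterI (filterI N1 N2) (filterI N3 N4)).
  move=> -[|y' [|y [|b [|c [|? ?]]]]]; rewrite /ab //=.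
  move=> [[[_ _ [rd1 _]] [[_ rd3] _ [rd2 _]]] [[_ w1] [w2 _]]] ww.
  rewrite rd1; first by apply/esym/rd2/rd3.
  by apply: w1; rewrite ww; apply/w2/rd3.
(* The values of the top legs, as functions of the two spokes they span. *)
pose Pab := app wab [:: $0; $1; app fc_ab [:: $0; $1; $2; $3; $4]].
pose Pac := app wac [:: $0; $1; app fb_ac [:: $0; $1; $2; $3; $4]].
pose Pbc := app wbc [:: $0; $1; app fa_bc [:: $0; $1; $2; $3; $4]].
have Paba : seq_analytic Pab [:: a0; b0; d0; ad0; bd0] by rewrite /Pab; analytic.
have Paca : seq_analytic Pac [:: a0; c0; d0; ad0; cd0] by rewrite /Pac; analytic.
have Pbca : seq_analytic Pbc [:: b0; c0; d0; bd0; cd0] by rewrite /Pbc; analytic.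
have PabE a b d ad bd : Pab [:: a; b; d; ad; bd] =
  wab [:: a; b; fc_ab [:: a; b; d; ad; bd]] by [].
have PacE a c d ad cd : Pac [:: a; c; d; ad; cd] =
  wac [:: a; c; fb_ac [:: a; c; d; ad; cd]] by [].
have PbcE b c d bd cd : Pbc [:: b; c; d; bd; cd] =
  wbc [:: b; c; fa_bc [:: b; c; d; bd; cd]] by [].
have PabcE : \forall s \near seq_nbhs [:: a0; b0; c0; d0; ad0; bd0; cd0],
    if s is [:: a; b; c; d; ad; bd; cd] then
      Pab [:: a; b; d; ad; bd] + Pbc [:: b; c; d; bd; cd] = Pac [:: a; c; d; ad; cd]
    else True.
  set s0 := [:: _; _; _; _; _; _; _].
  pose ab := app fc_ab [:: $0; $1; $3; $4; $5].
  pose ac := app fb_ac [:: $0; $2; $3; $4; $6].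
  pose bc := app fa_bc [:: $1; $2; $3; $5; $6].
  near_at N1 Na s0 [:: $1; $2; $3; bc; $5; $6].
  near_at N2 Nb s0 [:: $0; $2; $3; ac; $4; $6].
  near_at N3 Nc s0 [:: $0; $1; $3; ab; $4; $5].
  near_at N4 R_consistent s0 [:: $0; $1; $2; $3; ab; ac; bc; $4; $5; $6].
  near_at N5 Nw s0 [:: $0; $1; $2; ab; ac; bc].
  apply: filterS (filterI (filterI N1 N2) (filterI N3 (filterI N4 N5))).
  move=> -[|a [|b [|c [|d [|ad [|bd [|cd [|? ?]]]]]]]]; rewrite /ab /ac /bc //=.
  move=> [[[[_ ra] _ _] [[_ rb] _ _]] [[[_ rc] _ _] [[rd _ _] [w _]]]].
  by rewrite PabE PacE PbcE; apply/w/rd; [exact: ra|exact: rb|exact: rc].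
clearbody Pab Pac Pbc.
(* Base values for [c] and cd in [PabcE] split [Pab] into [wad] minus [wbd]. The choice of [wcd]
   makes [Pac] equal to [wad] minus [wcd], and [Pbc] to [wbd] minus [wcd], by further substitutions
   of base values. *)
pose wad := app Pac [:: $0; cst c0; $1; $2; cst cd0].
pose wbd := app Pbc [:: $0; cst c0; $1; $2; cst cd0].
pose wcd s := app wad [:: cst a0; $1; cst ad0] s -
  app Pac [:: cst a0; $0; $1; cst ad0; $2] s.
have wada : seq_analytic wad [:: a0; d0; ad0] by rewrite /wad; analytic.
have wbda : seq_analytic wbd [:: b0; d0; bd0] by rewrite /wbd; analytic.
have wcda : seq_analytic wcd [:: c0; d0; cd0] by rewrite /wcd; analytic.
exists wab, wac, wbc, wad, wbd, wcd; split=> //.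
set s0 := [:: _; _; _; _; _; _; _; _; _; _].
pose va := $0; pose vb := $1; pose vc := $2; pose vd := $3; pose vab := $4; pose vac := $5.
pose vbc := $6; pose vad := $7; pose vbd := $8; pose vcd := $9.
near_at Na' Na s0 [:: vb; vc; vd; vbc; vbd; vcd].
near_at Nb' Nb s0 [:: va; vc; vd; vac; vad; vcd].
near_at Nc' Nc s0 [:: va; vb; vd; vab; vad; vbd].
near_at Nd' Nw s0 [:: va; vb; vc; vab; vac; vbc].
near_at Ia wbc_inj s0 [:: vbc; app fa_bc [:: vb; vc; vd; vbd; vcd]; vb; vc].
near_at Ib wac_inj s0 [:: vac; app fb_ac [:: va; vc; vd; vad; vcd]; va; vc].
near_at Ic wab_inj s0 [:: vab; app fc_ab [:: va; vb; vd; vad; vbd]; va; vb].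
near_at P1 PabcE s0 [:: va; vb; cst c0; vd; vad; vbd; cst cd0].
near_at P2 PabcE s0 [:: cst a0; vb; vc; vd; cst ad0; vbd; vcd].
near_at P3 PabcE s0 [:: cst a0; vb; cst c0; vd; cst ad0; vbd; cst cd0].
near_at P4 PabcE s0 [:: va; cst b0; vc; vd; vad; cst bd0; vcd].
near_at P5 PabcE s0 [:: va; cst b0; cst c0; vd; vad; cst bd0; cst cd0].
near_at P6 PabcE s0 [:: cst a0; cst b0; vc; vd; cst ad0; cst bd0; vcd].
near_at P7 PabcE s0 [:: cst a0; cst b0; cst c0; vd; cst ad0; cst bd0; cst cd0].
apply: filterS (filterI (filterI (filterI Na' Nb') (filterI Nc' Nd'))
  (filterI (filterI Ia (filterI Ib Ic)) (filterI (filterI (filterI P1 P2) (filterI P3 P4))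
    (filterI P5 (filterI P6 P7))))).
rewrite /va /vb /vc /vd /vab /vac /vbc /vad /vbd /vcd => s.
case: s => [|a [|b [|c [|d [|ab [|ac [|bc [|ad [|bd [|cd [|? ?]]]]]]]]]]] //=.
rewrite /wcd /wad /wbd /= => -[[[[ra _ _] [rb _ _]] [[rc _ _] rd]]].
move=> [[Ia' [Ib' Ic']] [[[E1 E2] [E3 E4]] [E5 [E6 E7]]]].
have inj_iff (y y' w1 w2 : C) (P : Prop) : (P <-> y = y') -> (y = y' -> w1 = w2) ->
    (w1 = w2 -> y = y') -> (P <-> w1 = w2).
  by move=> [Py yP] yw wy; split=> [/Py/yw|/wy/yP].
split.
- have -> : forall x y z : C, (x + y = z) = (x = z - y).
    by move=> x y z; apply/propext; split=> [<-|->]; rewrite ?addrK ?subrK.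
  have -> : Pbc [:: b; c0; d; bd; cd0] -
    (Pac [:: a0; c0; d; ad0; cd0] - Pac [:: a0; c; d; ad0; cd]) =
      wbc [:: b; c; fa_bc [:: b; c; d; bd; cd]].
    by rewrite -PbcE -E2 -E3; ring.
  by apply: (inj_iff _ _ _ _ _ ra) => // ->.
- have -> : forall x y z : C, (x + y = z) = (x = z - y).
    by move=> x y z; apply/propext; split=> [<-|->]; rewrite ?addrK ?subrK.
  have -> : Pac [:: a; c0; d; ad; cd0] -
    (Pac [:: a0; c0; d; ad0; cd0] - Pac [:: a0; c; d; ad0; cd]) =
      wac [:: a; c; fb_ac [:: a; c; d; ad; cd]].
    by rewrite -PacE -E4 -E5 -E6 -E7; ring.
  by apply: (inj_iff _ _ _ _ _ rb) => // ->.
- have -> : forall x y z : C, (x + y = z) = (x = z - y).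
    by move=> x y z; apply/propext; split=> [<-|->]; rewrite ?addrK ?subrK.
  have -> : Pac [:: a; c0; d; ad; cd0] - Pbc [:: b; c0; d; bd; cd0] =
      wab [:: a; b; fc_ab [:: a; b; d; ad; bd]].
    by rewrite -PabE -E1; ring.
  by apply: (inj_iff _ _ _ _ _ rc) => // ->.
- exact: rd.
Qed.

End Tetrahedron.

(** * Tripodal forms on a 4-cell *)

Section Cell.
Context {C : numClosedFieldType} {C_complete : complete_field C}.
Local Notation T := {set 'I_5}.
Variables (X0 : T -> C) (H : 'I_5 -> (T -> C) -> Prop).
Implicit Types (xi : T -> C) (E : T) (L : seq T) (s : seq C) (p q : 'I_5).

Definition pair_avoiding p E : Prop := #|E| = 2%N /\ p \notin E.

Hypothesis H_X0 : forall p, H p X0.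
Hypothesis H_local : forall p xi xi',
  (forall E, pair_avoiding p E -> xi E = xi' E) -> H p xi -> H p xi'.
Hypothesis H_solved : forall p E, pair_avoiding p E -> exists f : (T -> C) -> C,
  [/\ analytic_at f X0, \forall xi \near X0, H p xi <-> xi E = f xi
    & forall xi xi', (forall E', pair_avoiding p E' -> E' != E -> xi E' = xi' E') ->
        f xi = f xi'].
Hypothesis H_implied : forall a b c p, uniq [:: a; b; c; p] ->
  \forall xi \near X0, H a xi -> H b xi -> H c xi -> H p xi.

(** Fields outside [L] get their base values, so that lists close to the base values yield fields
    close to [X0]. *)
Definition fields_of L s E : C := nth (X0 E) s (index E L).

Lemma fields_of_map L xi E : E \in L -> fields_of L [seq xi E | E <- L] E = xi E.
Proof.
by move=> EL; rewrite /fields_of (nth_map E) ?index_mem// nth_index.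
Qed.

Lemma fields_of_base L E : fields_of L [seq X0 E | E <- L] E = X0 E.
Proof.
have [/fields_of_map->//|nEL] := boolP (E \in L).
by rewrite /fields_of nth_default// size_map memNindex.
Qed.

Lemma map_fields_of L s : uniq L -> size s = size L -> [seq fields_of L s E | E <- L] = s.
Proof.
move=> uL sL; apply: (@eq_from_nth _ 0) => [|i]; rewrite size_map ?sL// => iL.
rewrite (nth_map finset.set0)// /fields_of index_uniq//; apply: set_nth_default.
by rewrite sL.
Qed.

Lemma near_fields_of L (Q : (T -> C) -> Prop) : (\forall xi \near X0, Q xi) ->
  \forall s \near seq_nbhs [seq X0 E | E <- L], Q (fields_of L s).
Proof.
move=> nQ; apply: (fin_near_seq (u := fun E s => fields_of L s E) nQ) => E.
  exact: seq_analytic_nth_default.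
exact: fields_of_base.
Qed.

Lemma analytic_fields_of L f : analytic_at f X0 ->
  seq_analytic (fun s => f (fields_of L s)) [seq X0 E | E <- L].
Proof.
move=> fa; apply: (fin_analytic_seq (u := fun E s => fields_of L s E) fa) => E.
  exact: seq_analytic_nth_default.
exact: fields_of_base.
Qed.

Section Face.
Variables (n p q r s : 'I_5).
Hypothesis npqrs_uniq : uniq [:: n; p; q; r; s].
Hypothesis npqrs_all : forall i, i \in [:: n; p; q; r; s].

(** The order is that of [edges_solved]: the fields at the vertices q, r, s of the triangle, then
    those on its edges. *)
Definition face_pairs : seq T :=
  [:: [set q; n]; [set r; n]; [set s; n]; [set q; r]; [set q; s]; [set r; s]]%SET.

Definition face_relation l : Prop := H p (fields_of face_pairs l).

Lemma face_pairs_uniq : uniq face_pairs.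
Proof.
pose f (E : T) := (q \in E, r \in E, s \in E, n \in E).
suff fE : map f face_pairs = [:: (true, false, false, true); (false, true, false, true);
    (false, false, true, true); (true, true, false, false); (true, false, true, false);
    (false, true, true, false)].
  by apply: (@map_uniq _ _ f); rewrite fE.
have := npqrs_uniq; rewrite /= !inE !negb_or -!andbA.
move=> /and5P[_ nq nr ns] /and5P[_ _ _ qr] /and3P[qs rs _].
have en (x y : 'I_5) : x != y -> (x == y = false) * (y == x = false).
  by move=> xy; rewrite [y == x]eq_sym (negPf xy).
have ne := (en _ _ nq, en _ _ nr, en _ _ ns, en _ _ qr, en _ _ qs, en _ _ rs, eqxx).
by rewrite /f /= !in_set2 !ne.
Qed.

Lemma face_pairsP E : pair_avoiding p E -> E \in face_pairs.
Proof.
move=> [/eqP/cards2P[x [y [xy ->]]]]; rewrite !inE negb_or => /andP[px py].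
have := npqrs_all x; have := npqrs_all y; rewrite !inE.
move: xy px py; rewrite !(eq_sym p).
by move=> xy /negPf-> /negPf-> /=; case/or4P => /eqP Ey; case/or4P => /eqP Ex;
  move: xy; rewrite Ex Ey ?eqxx// => _; rewrite ?eqxx ?orbT// finset.setUC ?eqxx ?orbT.
Qed.

Lemma face_relationE xi : face_relation [seq xi E | E <- face_pairs] <-> H p xi.
Proof.
by split; apply: H_local => E /face_pairsP EL; rewrite fields_of_map.
Qed.

Lemma face_list_map l : size l = 6%N ->
  exists xi, l = [seq xi E | E <- face_pairs] /\ fields_of face_pairs l = xi.
Proof.
move=> sl; exists (fields_of face_pairs l); split=> //.
by rewrite map_fields_of// face_pairs_uniq.
Qed.

Lemma face_edge_solved E (L := face_pairs) (L' := rem E face_pairs) :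
  pair_avoiding p E ->
  exists f, [/\ seq_analytic f [seq X0 E' | E' <- L'] &
    \forall l \near seq_nbhs [seq X0 E' | E' <- L], forall xi,
      l = [seq xi E' | E' <- L] -> face_relation l <-> xi E = f [seq xi E' | E' <- L']].
Proof.
move=> pE; have [f [fa fP f_local]] := H_solved pE.
exists (fun l => f (fields_of L' l)); split; first exact: analytic_fields_of.
apply: filterS (near_fields_of L fP) => l Hl xi lE.
rewrite lE in Hl *; apply: (iff_trans Hl); rewrite fields_of_map ?face_pairsP//.
rewrite (f_local _ (fields_of L' [seq xi E' | E' <- L']))// => E' pE' E'E.
have E'L := face_pairsP pE'; rewrite fields_of_map// fields_of_map//.
by rewrite (mem_rem_uniq _ face_pairs_uniq) inE E'E.
Qed.

Lemma face_edges_solved : exists f12 f13 f23,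
  edges_solved face_relation (X0 [set q; n]%SET) (X0 [set r; n]%SET) (X0 [set s; n]%SET)
    (X0 [set q; r]%SET) (X0 [set q; s]%SET) (X0 [set r; s]%SET) f12 f13 f23.
Proof.
have := face_pairs_uniq; have := npqrs_uniq; rewrite /= !inE !negb_or -!andbA.
move=> /and5P[_ _ _ _] /and5P[pq pr ps qr] /and3P[qs rs _].
move=> /and5P[n1 n2 n3 n4] /and5P[n5 n6 n7 n8] /and5P[n9 n10 n11 n12] /and4P[n13 n14 n15 _].
have pair_av (i j : 'I_5) : p != i -> p != j -> i != j -> pair_avoiding p [set i; j]%SET.
  by move=> pi pj ij; split; [rewrite cards2 ij|rewrite !inE negb_or pi].
have [f12 [f12a f12P]] := face_edge_solved (pair_av _ _ pq pr qr).
have [f13 [f13a f13P]] := face_edge_solved (pair_av _ _ pq ps qs).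
have [f23 [f23a f23P]] := face_edge_solved (pair_av _ _ pr ps rs).
have R1 : rem [set q; r]%SET face_pairs =
    [:: [set q; n]; [set r; n]; [set s; n]; [set q; s]; [set r; s]]%SET.
  by rewrite /= (negPf n3) (negPf n7) (negPf n10) eqxx.
have R2 : rem [set q; s]%SET face_pairs =
    [:: [set q; n]; [set r; n]; [set s; n]; [set q; r]; [set r; s]]%SET.
  by rewrite /= (negPf n4) (negPf n8) (negPf n11) (negPf n13) eqxx.
have R3 : rem [set r; s]%SET face_pairs =
    [:: [set q; n]; [set r; n]; [set s; n]; [set q; r]; [set q; s]]%SET.
  by rewrite /= (negPf n5) (negPf n9) (negPf n12) (negPf n14) (negPf n15) eqxx.
rewrite R1 in f12a f12P; rewrite R2 in f13a f13P; rewrite R3 in f23a f23P.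
exists f12, f13, f23; split=> //.
  have /= := face_relationE X0; rewrite /face_relation => -[_]; apply; exact: H_X0.
apply: filterS (filterI f12P (filterI f13P (filterI f23P (seq_nbhs_size _)))).
move=> l [h12 [h13 [h23 sl]]]; have [xi [lE _]] := face_list_map sl.
have := h12 xi lE; have := h13 xi lE; have := h23 xi lE.
by rewrite {h12 h13 h23 sl}lE /=.
Qed.

End Face.

Section Cell_tripodal.
Variables (n a b c d : 'I_5).
Hypothesis nabcd_uniq : uniq [:: n; a; b; c; d].
Hypothesis nabcd_all : forall i, i \in [:: n; a; b; c; d].

Definition cell_pairs : seq T :=
  [:: [set a; n]; [set b; n]; [set c; n]; [set d; n]; [set a; b]; [set a; c];
      [set b; c]; [set a; d]; [set b; d]; [set c; d]]%SET.

Lemma cell_pairs_uniq : uniq cell_pairs.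
Proof.
pose f (E : T) := (a \in E, b \in E, c \in E, d \in E).
suff fE : map f cell_pairs = [:: (true, false, false, false); (false, true, false, false);
    (false, false, true, false); (false, false, false, true); (true, true, false, false);
    (true, false, true, false); (false, true, true, false); (true, false, false, true);
    (false, true, false, true); (false, false, true, true)].
  by apply: (@map_uniq _ _ f); rewrite fE.
have := nabcd_uniq; rewrite /= !inE !negb_or -!andbA.
move=> /and5P[na nb nc nd] /and5P[ab ac ad bc] /and3P[bd cd _].
have en (x y : 'I_5) : x != y -> (x == y = false) * (y == x = false).
  by move=> xy; rewrite [y == x]eq_sym (negPf xy).
have ne := (en _ _ na, en _ _ nb, en _ _ nc, en _ _ nd, en _ _ ab, en _ _ ac, en _ _ ad,
  en _ _ bc, en _ _ bd, en _ _ cd, eqxx).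
by rewrite /f /= !in_set2 !ne.
Qed.

Lemma perm_face_uniq (l : seq 'I_5) : l =i [:: n; a; b; c; d] -> size l = 5%N -> uniq l.
Proof. by move=> lE sl; rewrite (@eq_uniq _ l [:: n; a; b; c; d] sl lE). Qed.

Lemma perm_face_all (l : seq 'I_5) : l =i [:: n; a; b; c; d] -> forall i, i \in l.
Proof. by move=> lE i; rewrite lE. Qed.

Definition leg (w : seq C -> C) (i j : 'I_5) (xi : T -> C) : C :=
  w [:: xi [set i; n]; xi [set j; n]; xi [set i; j]]%SET.

Lemma leg_analytic w i j :
  seq_analytic w [:: X0 [set i; n]; X0 [set j; n]; X0 [set i; j]]%SET ->
  analytic_at (leg w i j) X0.
Proof.
move=> wa; apply: (@seq_analytic_comp_fin _ _ _ w
  [:: fun xi => xi [set i; n]; fun xi => xi [set j; n]; fun xi => xi [set i; j]]%SET) => //.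
by do 3! [split; first exact/poly_analytic/poly_fun_var].
Qed.

(** The three pairs formed from [n], [i], [j] are the vertices of the common face of the facets [p]
    and [q]. *)
Lemma leg_local w i j p q xi xi' : uniq [:: n; i; j; p; q] ->
  (forall E, pair_avoiding p E -> q \notin E -> xi E = xi' E) ->
  leg w i j xi = leg w i j xi'.
Proof.
rewrite /= !inE !negb_or -!andbA => /and5P[ni nj np nq] /and5P[ij ip iq jp] /and3P[jq pq _] xx'.
have pair_av (k l : 'I_5) : k != l -> k != p -> l != p -> k != q -> l != q ->
    xi [set k; l]%SET = xi' [set k; l]%SET.
  move=> kl kp lp kq lq; apply: xx'; last by rewrite !inE negb_or !(eq_sym q) kq lq.
  by split; rewrite ?cards2 ?kl// !inE negb_or !(eq_sym p) kp lp.
by rewrite /leg !pair_av// eq_sym.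
Qed.

(* One of [A p q] and [A q p] for each pair, with the sign that makes the cocycle
   conditions tripodal forms; it is the function of the edge complementary to
   [p], [q]. *)
Definition half_leg (wab wac wbc wad wbd wcd : seq C -> C) p q : (T -> C) -> C :=
  if (p, q) == (d, c) then leg wab a b else
  if (p, q) == (b, d) then leg wac a c else
  if (p, q) == (d, a) then leg wbc b c else
  if (p, q) == (c, b) then leg wad a d else
  if (p, q) == (a, c) then leg wbd b d else
  if (p, q) == (b, a) then leg wcd c d else fun=> 0.

Lemma cell_tripodal : exists A : 'I_5 -> 'I_5 -> (T -> C) -> C,
  [/\ forall p q xi, A p q xi = - A q p xi,
      forall p q, analytic_at (A p q) X0,
      forall p q xi xi', (forall E, pair_avoiding p E -> q \notin E -> xi E = xi' E) ->
        A p q xi = A p q xi'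
    & forall p, p != n -> \forall xi \near X0,
        H p xi <-> \sum_(q | (q != p) && (q != n)) A p q xi = 0].
Proof.
have mem_abcd : [:: n; d; a; b; c] =i [:: n; a; b; c; d].
  by move=> x; rewrite !inE; do 5! case: (x == _).
have mem_abdc : [:: n; c; a; b; d] =i [:: n; a; b; c; d].
  by move=> x; rewrite !inE; do 5! case: (x == _).
have mem_acdb : [:: n; b; a; c; d] =i [:: n; a; b; c; d].
  by move=> x; rewrite !inE; do 5! case: (x == _).
have uc := perm_face_uniq mem_abdc erefl; have vc := perm_face_all mem_abdc.
have ub := perm_face_uniq mem_acdb erefl; have vb := perm_face_all mem_acdb.
have ud := perm_face_uniq mem_abcd erefl; have vd := perm_face_all mem_abcd.
have [fa1 [fa2 [fa3 Ra_solved]]] := face_edges_solved nabcd_uniq nabcd_all.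
have [fb1 [fb2 [fb3 Rb_solved]]] := face_edges_solved ub vb.
have [fc1 [fc2 [fc3 Rc_solved]]] := face_edges_solved uc vc.
have [fd1 [fd2 [fd3 Rd_solved]]] := face_edges_solved ud vd.
have Ha := face_relationE nabcd_all; have Hb := face_relationE vb.
have Hc := face_relationE vc; have Hd := face_relationE vd.
have R_consistent : \forall xi \near X0,
    [/\ H a xi -> H b xi -> H c xi -> H d xi, H a xi -> H c xi -> H d xi -> H b xi &
        H b xi -> H c xi -> H d xi -> H a xi].
  have u1 : uniq [:: a; b; c; d] by case/andP: nabcd_uniq.
  have u2 : uniq [:: a; c; d; b].
    by rewrite (@eq_uniq _ _ [:: a; b; c; d])// => x; rewrite !inE; do 4! case: (x == _).
  have u3 : uniq [:: b; c; d; a].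
    by rewrite (@eq_uniq _ _ [:: a; b; c; d])// => x; rewrite !inE; do 4! case: (x == _).
  apply: filterS (filterI (H_implied u1) (filterI (H_implied u2) (H_implied u3))).
  by move=> xi [? []].
have [|wab [wac [wbc [wad [wbd [wcd [[waba waca wbca] [wada wbda wcda] Nw]]]]]]] :=
  tetrahedron_cocycle Ra_solved Rb_solved Rc_solved Rd_solved.
  have nR := near_fields_of cell_pairs R_consistent.
  apply: filterS (filterI nR (seq_nbhs_size _)) => l [Rl sl].
  rewrite -(map_fields_of cell_pairs_uniq sl).
  set xi := fields_of cell_pairs l in Rl *.
  have [[a1 a2] [b1 b2]] := (Ha xi, Hb xi); have [[c1 c2] [d1 d2]] := (Hc xi, Hd xi).
  by case: Rl => i1 i2 i3; split=> [/a1 ? /b1 ? /c1 ?|/a1 ? /c1 ? /d1 ?|/b1 ? /c1 ? /d1 ?];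
    [apply/d2/i1|apply/b2/i2|apply/a2/i3].
pose U := half_leg wab wac wbc wad wbd wcd.
have Ua p q : analytic_at (U p q) X0.
  rewrite /U /half_leg; do 6! [case: ifP => _; first exact: leg_analytic].
  exact/poly_analytic/poly_fun_cst.
have U_local p q xi xi' : (forall E, pair_avoiding p E -> q \notin E -> xi E = xi' E) ->
    U p q xi = U p q xi'.
  move=> xx'; rewrite /U /half_leg; do 6! [case: ifP => [/eqP[pE qE]|_];
    first by apply: leg_local xx'; apply: perm_face_uniq => // x; rewrite pE qE !inE;
      do 5! case: (x == _)].
  by [].
exists (fun p q xi => U p q xi - U q p xi); split.
- by move=> p q xi; rewrite opprB.
- move=> p q; apply: (@seq_analytic_comp_fin _ _ _ (fun l => l`_0 - l`_1) [:: U p q; U q p]).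
    by apply: seq_analyticB; apply: seq_analytic_nth.
  by do 2! [split; first exact: Ua].
- move=> p q xi xi' xx'; rewrite (U_local p q _ _ xx') (U_local q p xi xi')// => E [E2 qE] pE.
  exact: xx'.
- have : uniq [:: n; a; b; c; d] := nabcd_uniq.
  rewrite /= !inE !negb_or -!andbA => /and5P[na nb nc nd] /and5P[ab ac ad bc] /and3P[bd cd _].
  have ne := (negPf na, negPf nb, negPf nc, negPf nd, negPf ab, negPf ac, negPf ad,
    negPf bc, negPf bd, negPf cd).
  have en (x y : 'I_5) : x != y -> (y == x) = false by rewrite eq_sym => /negPf.
  have ne' := (en _ _ na, en _ _ nb, en _ _ nc, en _ _ nd, en _ _ ab, en _ _ ac, en _ _ ad,
    en _ _ bc, en _ _ bd, en _ _ cd).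
  have sumE (P : pred 'I_5) (G : 'I_5 -> C) :
      \sum_(q | P q) G q = \sum_(q <- [:: n; a; b; c; d] | P q) G q.
    apply: perm_big; apply: uniq_perm (index_enum_uniq _) nabcd_uniq _ => q.
    by rewrite mem_index_enum nabcd_all.
  have iff0 (x y z : C) (P : Prop) : (P <-> x = y) -> z = x - y \/ z = y - x ->
      (P <-> z = 0).
    move=> [Pxy xyP] zE; split=> [/Pxy xy|z0]; first by case: zE => ->; rewrite xy subrr.
    apply: xyP; case: zE => zE; move: z0; rewrite zE => /eqP; rewrite subr_eq0 => /eqP//.
  have near_legs : \forall xi \near X0,
      [/\ H a xi <-> leg wbc b c xi + leg wcd c d xi = leg wbd b d xi,
          H b xi <-> leg wac a c xi + leg wcd c d xi = leg wad a d xi,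
          H c xi <-> leg wab a b xi + leg wbd b d xi = leg wad a d xi &
          H d xi <-> leg wab a b xi + leg wbc b c xi = leg wac a c xi].
    have ga : all_prop (fun u : (T -> C) -> C => analytic_at u X0)
        [seq (fun xi => xi E) | E <- cell_pairs].
      by rewrite /=; do 10! [split; first exact/poly_analytic/poly_fun_var].
    have nw := @seq_near_comp_fin C C_complete T
      [seq (fun xi => xi E) | E <- cell_pairs] X0 _ Nw ga.
    apply: filterS nw => xi /= [wa wb wc wd].
    split; [apply: iff_trans wa|apply: iff_trans wb|apply: iff_trans wc|apply: iff_trans wd];
      apply: iff_sym; [exact: Ha|exact: Hb|exact: Hc|exact: Hd].
  move=> p pn; apply: filterS near_legs => xi [La Lb Lc Ld].
  have := nabcd_all p; rewrite !inE (negPf pn) /=.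
  case/or4P => /eqP ->; rewrite sumE !big_cons big_nil /U /half_leg !xpair_eqE
    ?eqxx ?ne ?ne' /= ?addr0 ?sub0r ?subr0;
    [apply: iff0 La _|apply: iff0 Lb _|apply: iff0 Lc _|apply: iff0 Ld _];
    solve [left; ring | right; ring].
Qed.

End Cell_tripodal.

End Cell.

(** * Lattice points and index sets *)

Section Lattice.
Implicit Types (m : lattice_pt) (E : {set 'I_5}) (i j : 'I_5).

Lemma site_coord m E j : site m E 0 j = m 0 j + (j \in E)%:R.
Proof.
rewrite /site mxE summxE; congr (_ + _).
under eq_bigr do rewrite mxE eqxx /=.
have [jE|njE] := boolP (j \in E).
  by rewrite (bigD1 j)//= eqxx big1 ?addr0// => i /andP[_ /negPf]; rewrite eq_sym => ->.
by rewrite big1// => i iE; case: eqP => // ji; rewrite ji iE in njE.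
Qed.

Lemma site_inj m : injective (site m).
Proof.
move=> E E' EE'; apply/setP => j; have := congr1 (fun l : lattice_pt => l 0 j) EE'.
by rewrite !site_coord => /addrI; case: (j \in E); case: (j \in E').
Qed.

Lemma site_setU1 m i E : i \notin E -> site (m + e i) E = site m (i |: E)%SET.
Proof. by move=> iE; rewrite /site big_setU1//= addrA. Qed.

Lemma heightD m m' : height (m + m') = height m + height m'.
Proof. by rewrite /height -big_split/=; apply: eq_bigr => j _; rewrite mxE. Qed.

Lemma height_e i : height (e i) = 1.
Proof.
rewrite /height (bigD1 i)//= mxE !eqxx big1 ?addr0// => j /negPf ji.
by rewrite mxE ji andbF.
Qed.

Lemma heightN m : height (- m) = - height m.
Proof. by rewrite /height -sumrN; apply: eq_bigr => j _; rewrite mxE. Qed.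

Lemma e_inj : injective e.
Proof.
move=> i j /matrixP/(_ 0 i); rewrite !mxE !eqxx /=.
by case: eqP => // ->.
Qed.

Lemma exists_fifth (a b c d : 'I_5) : uniq [:: a; b; c; d] ->
  exists n, uniq [:: n; a; b; c; d] /\ forall i, i \in [:: n; a; b; c; d].
Proof.
move=> u; have [n nP] : exists n, n \notin [:: a; b; c; d].
  apply/existsP; rewrite -negb_forall; apply/negP => /forallP all_in.
  have := uniq_leq_size (enum_uniq 'I_5) (fun i _ => all_in i).
  by rewrite size_enum_ord.
have un : uniq [:: n; a; b; c; d] by rewrite cons_uniq nP.
have sub5 : {subset [:: n; a; b; c; d] <= enum 'I_5} by move=> j _; rewrite mem_enum.
have sz5 : (size (enum 'I_5) <= size [:: n; a; b; c; d])%N by rewrite size_enum_ord.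
exists n; split=> // i; have [_ lE] := uniq_min_size un sub5 sz5.
by rewrite lE mem_enum.
Qed.

Lemma exists_others (n : 'I_5) : exists a b c d : 'I_5,
  uniq [:: n; a; b; c; d] /\ forall i, i \in [:: n; a; b; c; d].
Proof.
have eN : size (rem n (enum 'I_5)) = 4%N.
  by rewrite size_rem ?mem_enum// size_enum_ord.
have pE : perm_eq (enum 'I_5) (n :: rem n (enum 'I_5)) by rewrite perm_to_rem ?mem_enum.
case: (rem n (enum 'I_5)) eN pE => [|a [|b [|c [|d []]]]] // _ pE.
exists a, b, c, d; split=> [|i]; first by rewrite -(perm_uniq pE) enum_uniq.
by rewrite -(perm_mem pE) mem_enum.
Qed.

End Lattice.

(** * Transfer of the tripodal forms of a 4-cell to the lattice *)

Section LatticeCell.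
Context {C : numClosedFieldType} {C_complete : complete_field C}.
Variables (F : forall p : 'I_5, (oct_index p -> C) -> C) (x0 : lattice_pt -> C).
Hypothesis hF : octahedron_type_near F x0.
Local Notation T := {set 'I_5}.

(* A 4-cell whose fields are [x (site m (psi E))] for the pairs [E]; its facet
   [p] is the octahedron [(p, o p)], with vertices labelled by [lab p]. *)
Variables (m : lattice_pt) (psi : T -> T) (lab : forall p : 'I_5, oct_index p -> T)
  (o : 'I_5 -> lattice_pt) (P : 'I_5 -> 'I_5 -> pred T).
Arguments F : clear implicits.
Arguments lab : clear implicits.
Hypothesis psiK : involutive psi.
Hypothesis height_o : forall p, height (o p) = - 2%:Z.
Hypothesis site_o : forall p (E : oct_index p), site (o p) (val E) = site m (psi (lab p E)).
Hypothesis lab_pair : forall p E, pair_avoiding p (lab p E).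
Hypothesis lab_onto : forall p E, pair_avoiding p E -> exists E', lab p E' = E.
Hypothesis lab_inj : forall p, injective (lab p).
Hypothesis P_psi : forall p q E, pair_avoiding p E -> q \notin E -> P p q (psi E).
Hypothesis implied : forall a b c p, uniq [:: a; b; c; p] -> \forall x \near x0,
  holds F x (a, o a) -> holds F x (b, o b) -> holds F x (c, o c) -> holds F x (p, o p).

Let X (x : lattice_pt -> C) (E : T) : C := x (site m (psi E)).
Let H (p : 'I_5) (xi : T -> C) : Prop := F p (fun E => xi (lab p E)) = 0.

Lemma holdsE x p : holds F x (p, o p) = H p (X x).
Proof.
rewrite /holds /H; congr (F _ _ = 0); apply/funext => E.
by rewrite /oct_fields /X/= site_o.
Qed.

Lemma near_cell (Q : (T -> C) -> Prop) :
  (\forall xi \near X x0, Q xi) -> \forall x \near x0, Q (X x).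
Proof.
move=> /near_ballP[d d0 dQ]; apply/near_ballP; exists d => // x xd.
by apply: dQ => E; apply: xd.
Qed.

(** Makes a lattice function out of the fields of the cell. The index set of a site is recovered as
    the set of coordinates in which it differs from [m]; the values [x0] elsewhere keep the function
    close to [x0] on the whole lattice. *)
Let ext (xi : T -> C) (l : lattice_pt) : C :=
  let E := [set j | l 0 j != m 0 j]%SET in
  if l == site m E then xi (psi E) else x0 l.

Lemma X_ext xi : X (ext xi) = xi.
Proof.
apply/funext => E; rewrite /X /ext.
have -> : [set j | site m (psi E) 0 j != m 0 j]%SET = psi E.
  apply/setP => j; rewrite inE site_coord -subr_eq0 addrC addKr.
  by case: (j \in psi E).
by rewrite eqxx psiK.
Qed.

Lemma near_ext (Q : (lattice_pt -> C) -> Prop) :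
  (\forall x \near x0, Q x) -> \forall xi \near X x0, Q (ext xi).
Proof.
move=> /near_ballP[d d0 dQ]; apply/near_ballP; exists d => // xi xid.
apply: dQ => l; rewrite /ext; case: eqP => [->|_]; last by rewrite subrr normr0.
have -> : [set j | site m [set j | l 0 j != m 0 j]%SET 0 j != m 0 j]%SET =
    [set j | l 0 j != m 0 j]%SET.
  apply/setP => j; rewrite inE site_coord -subr_eq0 addrC addKr.
  by case: (j \in _).
set E := [set j | _]%SET; have := xid (psi E); by rewrite /X psiK.
Qed.

Lemma cell_solved p E : pair_avoiding p E -> exists f : (T -> C) -> C,
  [/\ analytic_at f (X x0), \forall xi \near X x0, H p xi <-> xi E = f xi
    & forall xi xi', (forall E', pair_avoiding p E' -> E' != E -> xi E' = xi' E') ->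
        f xi = f xi'].
Proof.
move=> /lab_onto[v <-]; have [_ _ /(_ v)[f [fa fP _]]] := @hF p (o p) (height_o p).
have z0E (w : oct_index p) : X x0 (lab p w) = oct_fields x0 (o := (p, o p)) w.
  by rewrite /oct_fields /X/= site_o.
exists (fun xi => f (fun w => xi (lab p (val w)))); split.
- apply: (analytic_comp (g := fun w xi => xi (lab p (val w))) fa) => w.
    exact/poly_analytic/poly_fun_var.
  exact: z0E.
- apply: (near_comp (g := fun w xi => xi (lab p w)) _ z0E fP) => w.
  exact/poly_analytic/poly_fun_var.
- move=> xi xi' xx'; congr f; apply/funext => w; apply: xx' => //.
  by apply: contra (valP w) => /eqP/lab_inj ->.
Qed.

Lemma lattice_cell_tripodal (n : 'I_5) :
  exists A : forall p q : 'I_5, ({E : T | P p q E} -> C) -> C,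
    [/\ forall p q (xi : T -> C), A p q (fun E => xi (val E)) = - A q p (fun E => xi (val E)),
        forall p q, analytic_at (A p q) (fun E => x0 (site m (val E)))
      & forall p, p != n -> \forall x \near x0,
          holds F x (p, o p) <->
          \sum_(q | (q != p) && (q != n)) A p q (fun E => x (site m (val E))) = 0].
Proof.
have [a [b [c [d [nu nall]]]]] := exists_others n.
have [p|p xi xi' xx'|a' b' c' p u|A [A_anti A_an A_loc A_holds]] :=
  @cell_tripodal _ _ (X x0) H _ _ cell_solved _ _ _ _ _ _ nu nall.
- by have [_ F0 _] := @hF p (o p) (height_o p); rewrite -holdsE.
- rewrite /H => <-; congr (F _); apply/funext => E; exact/esym/xx'.
- have := near_ext (implied u); apply: filterS => xi.
  by rewrite !holdsE X_ext.
(* The fields off the common face are filled in with base values; by [A_loc] this does not affect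
   the leg. *)
pose ext_face p q (z : {E : T | P p q E} -> C) (E : T) : C :=
  if insub (psi E) is Some u then z u else X x0 E.
have ext_faceE p q (xi : T -> C) : A p q (ext_face p q (fun E => xi (val E))) =
    A p q (fun E => xi (psi E)).
  apply: A_loc => E pE qE; rewrite /ext_face.
  by case: insubP => [u _ ->|]//; rewrite P_psi.
exists (fun p q z => A p q (ext_face p q z)); split.
- by move=> p q xi; rewrite !ext_faceE A_anti.
- move=> p q; apply: (analytic_comp (g := fun E z => ext_face p q z E) (A_an p q)) => E.
    rewrite /ext_face; case: insubP => [u _ _|_]; first exact/poly_analytic/poly_fun_var.
    exact/poly_analytic/poly_fun_cst.
  by rewrite /ext_face; case: insubP => [u _ ->|].
- move=> p pn; apply: filterS (near_cell (A_holds p pn)) => x; rewrite holdsE.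
  by under [X in _ -> (_ <-> X = 0)]eq_bigr do rewrite (ext_faceE _ _ (x \o site m)).
Qed.

End LatticeCell.

(** * From tripodal forms to consistency *)

Section Converse.
Context {C : numClosedFieldType} {C_complete : complete_field C}.
Variables (F : forall p : 'I_5, (oct_index p -> C) -> C) (x0 : lattice_pt -> C).
Arguments F : clear implicits.
Local Notation T := {set 'I_5}.
Implicit Types (m : lattice_pt) (x y : lattice_pt -> C).

(* The sum of all the [A q r] vanishes by antisymmetry. *)
Lemma antisym_sum0 (n p : 'I_5) (A : 'I_5 -> 'I_5 -> C) : p != n ->
  (forall q r, q != n -> r != n -> q != r -> A q r = - A r q) ->
  (forall r, r != n -> r != p -> \sum_(q | (q != r) && (q != n)) A r q = 0) ->
  \sum_(q | (q != p) && (q != n)) A p q = 0.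
Proof.
move=> pn Aanti A0; pose S r := \sum_(q | (q != r) && (q != n)) A r q.
pose t : C := \sum_(r | r != n) S r.
have tN : t = - t.
  rewrite {1}/t /S (exchange_big_dep (fun q => q != n))/=; last by move=> r q _ /andP[].
  rewrite -sumrN; apply: eq_bigr => q qn; rewrite /S -sumrN.
  apply: eq_big => [r|r /and3P[rn rq _]]; first by rewrite andbC eq_sym qn andbT.
  by apply: Aanti => //; rewrite eq_sym.
have t0 : t = 0.
  have : t *+ 2 == 0 by rewrite mulr2n {2}tN subrr.
  by rewrite mulrn_eq0 => /eqP.
have : t = S p by rewrite /t (bigD1 p)//= big1 ?addr0// => r /andP[rn rp]; apply: A0.
by rewrite t0 -[RHS]/(S p) => /esym.
Qed.

(** The base points [o] and the predicates [P] are left open so that both kinds of 4-cell are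
    covered. *)
Lemma legs_implied m (o : 'I_5 -> lattice_pt) (P : 'I_5 -> 'I_5 -> pred T)
    (A : forall p q : 'I_5, ({E : T | P p q E} -> C) -> C) (n a b c p : 'I_5) :
  uniq [:: n; a; b; c; p] -> (forall i, i \in [:: n; a; b; c; p]) ->
  (forall p q, p != n -> q != n -> p != q -> forall xi : T -> C,
     A p q (fun E => xi (val E)) = - A q p (fun E => xi (val E))) ->
  (forall p, p != n -> \forall x \near x0, holds F x (p, o p) <->
     \sum_(q | (q != p) && (q != n)) A p q (fun E => x (site m (val E))) = 0) ->
  \forall x \near x0, holds F x (a, o a) -> holds F x (b, o b) -> holds F x (c, o c) ->
    holds F x (p, o p).
Proof.
rewrite /= !inE !negb_or -!andbA => /and5P[na nb nc np _] nall A_anti A_holds.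
rewrite !(eq_sym n) in na nb nc np.
apply: filterS (filterI (filterI (A_holds a na) (A_holds b nb))
  (filterI (A_holds c nc) (A_holds p np))) => x [[[Ha _] [Hb _]] [[Hc _] [_ Hp]]].
move=> /Ha a0 /Hb b0 /Hc c0; apply: Hp.
apply: (antisym_sum0 (A := fun r q => A r q (fun E => x (site m (val E))))) => //.
  by move=> q r qn rn qr; apply: (A_anti _ _ qn rn qr (x \o site m)).
move=> r rn rp; have := nall r; rewrite !inE (negPf rn) (negPf rp) /= orbF.
by case/or3P => /eqP ->.
Qed.

Lemma tripodal_implied : (forall n : 'I_5,
    (forall m, height m = - 2%:Z -> tripodal_sum F x0 n m) /\
    (forall m, height m = - 3%:Z -> shifted_tripodal_sum F x0 n m)) ->
  forall a b c p, uniq [:: a; b; c] -> p \notin [:: a; b; c] ->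
    implied_by_triple F x0 a b c p.
Proof.
move=> tri a b c p uabc pabc.
have u : uniq [:: a; b; c; p].
  by rewrite -[[:: _; _; _; _]]/(rcons [:: a; b; c] p) rcons_uniq pabc.
have [n [nu nall]] := exists_fifth u; have [tri2 tri3] := tri n.
split=> [m /tri2|m /tri3] [A [A_anti _ A_holds]].
  exact: (legs_implied (o := fun=> m) nu nall A_anti A_holds).
exact: (legs_implied (o := fun p => m + e p) nu nall A_anti A_holds).
Qed.

Hypothesis hF : octahedron_type_near F x0.

(** Induction along the list: the first equation is solved for its new vertex [v], and the value
    found replaces the datum there. By continuity the new data [y'] are still close to [x0]; the
    later steps keep the fields on [v :: D], which contains all vertices of the octahedron just
    treated. *)
Lemma sequential_solution (s : seq (octahedron * lattice_pt)) (D : seq lattice_pt) :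
  determines D s -> (forall ov, ov \in s -> height ov.1.2 = - 2%:Z) ->
  forall U, nbhs x0 U -> \forall y \near x0, exists x,
    [/\ U x, {in D, x =1 y} & forall ov, ov \in s -> holds F x ov.1].
Proof.
elim: s D => [|ov s IH] D /=.
  by move=> _ _ U nU; apply: filterS nU => y Uy; exists y.
case: ov => o v /and4P[vo vD /allP oD s_det] hs U nU.
have {IH} nV := IH _ s_det (fun ov ovs => hs ov (mem_behead (s := (o, v) :: s) ovs)) U nU.
case: o vo oD hs => p m vo oD hs; have hm : height m = - 2%:Z := hs _ (mem_head _ _).
have /codomP[w vE] : v \in codom (fun E : oct_index p => site m (val E)) := vo.
have [_ F0 /(_ w)[f [fa fP _]]] := @hF p m hm.
pose rest x (u : {u : oct_index p | u != w}) : C := x (site m (val (val u))).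
have f0 : f (rest x0) = x0 v.
  by have [fz _] := nbhs_singleton fP; rewrite vE -(fz F0).
have nVF : \forall x \near x0, (exists x', [/\ U x', {in v :: D, x' =1 x}
      & forall ov, ov \in s -> holds F x' ov.1]) /\
    (F p (fun E => x (site m (val E))) = 0 <-> x v = f (rest x)).
  apply: filterI nV _; move/near_ballP: fP => [d d0 dP]; apply/near_ballP.
  exists d => // x xd; rewrite vE; exact: (dP (fun E => x (site m (val E)))).
move/near_ballP: nVF => [d d0 dP].
have : \forall y \near x0, `|f (rest y) - f (rest x0)| < d.
  have /near_ballP[d' d'0 fd'] := analytic_continuous (C_complete := C_complete) fa d0.
  by apply/near_ballP; exists d' => // y yd; apply: fd' => u; apply: yd.
move=> /near_ballP[d1 d10 fd]; have [d2 [d20 d21 d2d]] := lt_min2 d10 d0.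
apply/near_ballP; exists d2 => // y yd.
pose y' l := if l == v then f (rest y) else y l.
have rest_y' : rest y' = rest y.
  apply/funext => u; rewrite /rest /y' vE; case: eqP => // /site_inj/val_inj uw.
  by have := valP u; rewrite /= uw eqxx.
have [l|[x [Ux xy' xs]] [_ y'h]] := dP y'.
  rewrite /y'; case: eqP => [->|_]; last exact: lt_le_trans (yd l) d2d.
  by rewrite -f0; apply: fd => l'; apply: lt_le_trans (yd l') d21.
exists x; split=> // [l lD|ov]; last first.
  rewrite inE => /predU1P[->|]; last exact: xs.
  rewrite /holds/= (_ : oct_fields x (o := (p, m)) =
      fun E : oct_index p => y' (site m (val E))).
    by apply/y'h; rewrite rest_y' /y' eqxx.
  apply/funext => E; apply: xy'; rewrite inE; apply: oD; exact: codom_f.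
rewrite xy' ?inE ?lD ?orbT// /y'; case: eqP => // lv.
by rewrite lv (negPf vD) in lD.
Qed.

(** Five of the six equations can be solved successively. The octahedron [(i, m)] is a facet of both
    4-cells, those with base points [m] and [n]. The cell not containing the sixth octahedron has
    its full triple and yields the equation on [(i, m)]; with the two equations left in the other
    cell this gives the sixth. *)
Lemma implied_consistent :
  (forall a b c p, uniq [:: a; b; c] -> p \notin [:: a; b; c] ->
    implied_by_triple F x0 a b c p) ->
  forall a b c, uniq [:: a; b; c] -> consistent_triple F x0 a b c.
Proof.
move=> imp a b c uabc i m iabc hm D [_ _ _ [s [s5 us s_os s_det]]] U nU.
set os := adjacent_triples a b c i m in s_os *.
pose n := m - e i.
have hn : height n = - 3%:Z by rewrite /n heightD heightN hm height_e.
have ei j : n + e j = m + e j - e i by rewrite /n addrAC.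
have nei : n + e i = m by rewrite /n subrK.
have hos ov : ov \in s -> height ov.1.2 = - 2%:Z.
  move=> ovs; have : ov.1 \in os by apply: s_os; apply: map_f.
  have h j : height (m + e j - e i) = - 2%:Z.
    by rewrite !heightD heightN hm !height_e.
  by rewrite !inE => /or4P[|||/or3P[]] /eqP ->; rewrite /= ?h.
move: iabc uabc; rewrite /= !inE !negb_or andbT => /and3P[ia ib ic] /andP[/andP[ab ac] bc].
have u4 (j k l p : 'I_5) : j != k -> j != l -> k != l -> p != j -> p != k -> p != l ->
    implied_by_triple F x0 j k l p.
  by move=> jk jl kl pj pk pl; apply: imp; rewrite /= !inE ?negb_or ?jk ?jl ?kl ?pj ?pk ?pl.
have [[ai bi ci] [ba ca cb]] : [/\ a != i, b != i & c != i] /\ [/\ b != a, c != a & c != b].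
  by split; split; rewrite eq_sym.
have facet j k l p : implied_by_triple F x0 j k l p -> \forall x \near x0,
    (holds F x (j, m) -> holds F x (k, m) -> holds F x (l, m) -> holds F x (p, m)) /\
    (holds F x (j, n + e j) -> holds F x (k, n + e k) -> holds F x (l, n + e l) ->
      holds F x (p, n + e p)).
  by move=> [imp2 imp3]; apply: filterI; [exact: imp2|exact: imp3].
have near_imp : \forall x \near x0, U x /\
    ((holds F x (a, m) -> holds F x (b, m) -> holds F x (c, m) -> holds F x (i, m)) /\
     (holds F x (a, n + e a) -> holds F x (b, n + e b) -> holds F x (c, n + e c) ->
        holds F x (i, m))) /\
    [/\ (holds F x (b, m) -> holds F x (c, m) -> holds F x (i, m) -> holds F x (a, m)) /\
        (holds F x (b, n + e b) -> holds F x (c, n + e c) -> holds F x (i, m) ->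
          holds F x (a, n + e a)),
        (holds F x (a, m) -> holds F x (c, m) -> holds F x (i, m) -> holds F x (b, m)) /\
        (holds F x (a, n + e a) -> holds F x (c, n + e c) -> holds F x (i, m) ->
          holds F x (b, n + e b)) &
        (holds F x (a, m) -> holds F x (b, m) -> holds F x (i, m) -> holds F x (c, m)) /\
        (holds F x (a, n + e a) -> holds F x (b, n + e b) -> holds F x (i, m) ->
          holds F x (c, n + e c))].
  have f1 := facet _ _ _ _ (u4 a b c i ab ac bc ia ib ic).
  have f2 := facet _ _ _ _ (u4 b c i a bc bi ci ab ac ai).
  have f3 := facet _ _ _ _ (u4 a c i b ac ai ci ba bc bi).
  have f4 := facet _ _ _ _ (u4 a b i c ab ai bi ca cb ci).
  apply: filterS (filterI (filterI nU f1) (filterI f2 (filterI f3 f4))) => x.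
  by rewrite nei => -[[Ux g1] [g2 [g3 g4]]].
have := sequential_solution s_det hos near_imp; apply: filterS => y [x [[Ux [xi xabc]] xy xs]].
exists x; split=> //.
have neq j : j != i -> (j, m) != (j, n + e j).
  move=> ji; rewrite xpair_eqE eqxx /=; apply/eqP => mE.
  have /e_inj ij : e i = e j by apply: (addrI n); rewrite nei.
  by rewrite ij eqxx in ji.
(* At most one of the six equations is missing from the five used. *)
have others o0 : o0 \in os -> ~ holds F x o0 -> forall o, o \in os -> o != o0 -> holds F x o.
  move=> o0s no0 o os_o oo0; have us1 := us.
  have o0s1 : o0 \notin [seq ov.1 | ov <- s].
    by apply/mapP => -[ov ovs oE]; apply: no0; rewrite oE; apply: xs.
  have u6 : uniq (o0 :: [seq ov.1 | ov <- s]) by rewrite /= o0s1.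
  have sub6 : {subset o0 :: [seq ov.1 | ov <- s] <= os}.
    by move=> o1; rewrite inE => /predU1P[->//|/s_os].
  have sz6 : (size os <= size (o0 :: [seq ov.1 | ov <- s]))%N by rewrite /= size_map s5.
  have [_ osE] := uniq_min_size u6 sub6 sz6.
  by move: os_o; rewrite -osE inE (negPf oo0) => /mapP[ov ovs ->]; apply: xs.
have osE : os = [:: (a, m); (b, m); (c, m); (a, n + e a); (b, n + e b); (c, n + e c)].
  by rewrite /os /adjacent_triples !ei.
move: others; rewrite osE => others o o_os; apply: contrapT => no.
have {}others := others o o_os no.
have [[xi1 xi2] [[xa1 xa2] [xb1 xb2] [xc1 xc2]]] := (xi, xabc).
have ne (j k : 'I_5) m1 m2 : j != k -> ((j, m1) : octahedron) != (k, m2).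
  by move=> jk; rewrite xpair_eqE (negPf jk).
have na := neq a ai; have nb := neq b bi; have nc := neq c ci.
have oth o1 : o1 \in [:: (a, m); (b, m); (c, m); (a, n + e a); (b, n + e b); (c, n + e c)] ->
  o1 != o -> holds F x o1 := others o1.
apply: no; move: o_os oth; rewrite !inE.
case/or4P => [/eqP->|/eqP->|/eqP->|/or3P[]/eqP->] oth.
- apply: xa1; [| |apply: xi2]; apply: oth; first [by rewrite !inE eqxx ?orbT | by apply: ne | by rewrite eq_sym | by []].
- apply: xb1; [| |apply: xi2]; apply: oth; first [by rewrite !inE eqxx ?orbT | by apply: ne | by rewrite eq_sym | by []].
- apply: xc1; [| |apply: xi2]; apply: oth; first [by rewrite !inE eqxx ?orbT | by apply: ne | by rewrite eq_sym | by []].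
- apply: xa2; [| |apply: xi1]; apply: oth; first [by rewrite !inE eqxx ?orbT | by apply: ne | by rewrite eq_sym | by []].
- apply: xb2; [| |apply: xi1]; apply: oth; first [by rewrite !inE eqxx ?orbT | by apply: ne | by rewrite eq_sym | by []].
- apply: xc2; [| |apply: xi1]; apply: oth; first [by rewrite !inE eqxx ?orbT | by apply: ne | by rewrite eq_sym | by []].
Qed.

End Converse.

(** * The two kinds of 4-cell and the equivalence *)

Section Main.
Context {C : numClosedFieldType} {C_complete : complete_field C}.
Variables (F : forall p : 'I_5, (oct_index p -> C) -> C) (x0 : lattice_pt -> C).
Hypothesis hF : octahedron_type_near F x0.

Lemma cards2_setC (E : {set 'I_5}) : (#|E| = 2%N) -> #|~: E|%SET = 3%N.
Proof. by move=> E2; have := cardsC E; rewrite E2 card_ord => /(@addnI 2 _ 3). Qed.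

Lemma consistent_tripodal n m : consistent_4D F x0 -> height m = - 2%:Z ->
  tripodal_sum F x0 n m.
Proof.
move=> cons hm.
have [||p E|p E|p E [E2 pE]|p|p q E [E2 pE] qE|a b c p u|A [A_anti A_an A_holds]] :=
  @lattice_cell_tripodal C C_complete F x0 hF m id (fun p E => val E) (fun=> m)
    (fun p q E => [&& #|E| == 2%N, p \notin E & q \notin E]) _ _ _ _ _ _ _ _ n.
- by [].
- by [].
- by [].
- by case/andP: (valP E) => /eqP.
- by exists (exist _ E (introT andP (conj (introT eqP E2) pE))).
- exact: val_inj.
- by rewrite E2 eqxx pE.
- move: u; rewrite -[[:: _; _; _; _]]/(rcons [:: a; b; c] p) rcons_uniq => /andP[pn u].
  by have [_ /(_ p pn)[imp _]] := cons a b c u; apply: imp.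
by exists A; split=> // p q *; [exact: A_anti|exact: A_an].
Qed.

(** A vertex of the shifted facet [p] is a triple containing [p]; it is labelled by the
    complementary pair, which avoids [p]. Complementation also carries the common face of two
    shifted facets to the pairs avoiding both indices. *)
Lemma consistent_shifted_tripodal n m : consistent_4D F x0 -> height m = - 3%:Z ->
  shifted_tripodal_sum F x0 n m.
Proof.
move=> cons hm.
have card_lab (p : 'I_5) (E : {set 'I_5}) : #|E| = 2%N -> p \notin E ->
    pair_avoiding p (~: (p |: E))%SET.
  move=> E2 pE; split; last by rewrite !inE eqxx.
  by have := cardsC (p |: E)%SET; rewrite cardsU1 pE E2 card_ord => /(@addnI 3 _ 2).
have [||p E|p E|p E [E2 pE]|p|p q E [E2 pE] qE|a b c p u|A [A_anti A_an A_holds]] :=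
  @lattice_cell_tripodal C C_complete F x0 hF m (fun E => ~: E)%SET
    (fun p E => ~: (p |: val E))%SET (fun p => m + e p)
    (fun p q E => [&& #|E| == 3%N, p \in E & q \in E]) _ _ _ _ _ _ _ _ n.
- exact: finset.setCK.
- by move=> p; rewrite heightD hm height_e.
- by rewrite finset.setCK site_setU1//; case/andP: (valP E).
- by case/andP: (valP E) => /eqP E2 pE; apply: card_lab.
- have [lE plE] := card_lab p E E2 pE.
  have lP : (#|~: (p |: E)|%SET == 2%N) && (p \notin ~: (p |: E))%SET by rewrite lE eqxx.
  exists (exist (fun E : {set 'I_5} => (#|E| == 2%N) && (p \notin E)) _ lP) => /=.
  apply/setP => j; rewrite !inE; case: eqP => [->|] /=; first by rewrite (negPf pE).
  by rewrite negbK.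
- move=> E E' /finset.setC_inj EE'; apply/val_inj/setP => j.
  have := congr1 (fun S : {set 'I_5} => j \in S) EE'; rewrite /= !inE.
  have [->|//] := eqVneq j p.
  by case/andP: (valP E) => _ /negPf->; case/andP: (valP E') => _ /negPf->.
- by rewrite cards2_setC// !inE pE qE.
- move: u; rewrite -[[:: _; _; _; _]]/(rcons [:: a; b; c] p) rcons_uniq => /andP[pn u].
  by have [_ /(_ p pn)[_ imp]] := cons a b c u; apply: imp.
by exists A; split=> // p q *; [exact: A_anti|exact: A_an].
Qed.

Lemma tripodal_criterion : consistent_4D F x0 <->
  forall n : 'I_5,
    (forall m : lattice_pt, height m = - 2%:Z -> tripodal_sum F x0 n m) /\
    (forall m : lattice_pt, height m = - 3%:Z -> shifted_tripodal_sum F x0 n m).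
Proof.
split=> [cons n|tri a b c u].
  by split=> m hm; [exact: consistent_tripodal|exact: consistent_shifted_tripodal].
have imp := tripodal_implied tri; split; last by move=> p; apply: imp.
exact: implied_consistent.
Qed.

End Main.

Theorem theorem6 (R : realType)
    (F : forall p : 'I_5, (oct_index p -> R[i]) -> R[i])
    (x0 : lattice_pt -> R[i])
    (hF : octahedron_type_near F x0) :
  consistent_4D F x0 <->
  forall n : 'I_5,
    (forall m : lattice_pt, height m = - 2%:Z -> tripodal_sum F x0 n m) /\
    (forall m : lattice_pt, height m = - 3%:Z -> shifted_tripodal_sum F x0 n m).
Proof. exact: (@tripodal_criterion _ (complex_complete_field R)). Qed.
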